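(* Let $X$ be an Archimedean lattice-ordered algebra with identity $1_X$. Then $X$ admits a polynomial growth continuous function calculus if and only if $X$ is an $f$-algebra and, for every $n\in\mathbb{N}$ and every $x_1,\ldots,x_n\in X$, there exists $f\in X$ with $f\ge 1_X\vee|x_1|\vee\cdots\vee|x_n|$ such that, for every $m\in\mathbb{N}$, the norm $\|\cdot\|_{f^m}$ is complete on the closed sublattice generated by $x_1,\ldots,x_n$ in $I_{f^m}$. In this case, the polynomial growth continuous function calculus is unique, in the sense that for each $n\in\mathbb{N}$ and $\bm{x}=(x_1,\ldots,x_n)\in X^n$ there is only one lattice-algebra homomorphism $\Psi_{\bm{x}}\colon PG_n\to X$ which satisfies $\Psi_{\bm{x}}(\mathbf{1})=1_X$ and $\Psi_{\bm{x}}(\pi_i)=x_i$ for $i=1,\ldots,n$; and $$\Psi_{(\Psi_{\bm{x}}(f_1),\ldots,\Psi_{\bm{x}}(f_m))}(g)=\Psi_{\bm{x}}(g\circ(f_1\times\cdots\times f_m))$$ for each $m,n\in\mathbb{N}$, $\bm{x}\in X^n$, $f_1,\ldots,f_m\in PG_n$ and $g\in PG_m$, where $f_1\times\cdots\times f_m\colon\mathbb{R}^n\to\mathbb{R}^m$ is the function defined by $(f_1\times\cdots\times f_m)(t)=(f_1(t),\ldots,f_m(t))$ for $t\in\mathbb{R}^n$.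
   Context: Here $\mathbb{N}=\{1,2,\ldots\}$. A lattice-ordered algebra is a real vector lattice that is also an associative real algebra in which the product of positive elements is positive. An $f$-algebra is a lattice-ordered algebra in which $x\wedge y=0$ and $z\ge 0$ imply $(zx)\wedge y=(xz)\wedge y=0$. A lattice-algebra homomorphism is a linear map preserving lattice operations and products. For a vector lattice $X$ and $e\in X_+$, $I_e$ denotes the order ideal of $X$ generated by $e$, with norm $\|x\|_e=\inf\{\lambda\in[0,\infty):|x|\le\lambda e\}$. The closed sublattice generated by $x_1,\ldots,x_n$ in $I_e$ is the smallest vector sublattice of $I_e$ that contains $x_1,\ldots,x_n$ and is closed for $\|\cdot\|_e$. $PG_n$ denotes the lattice-ordered algebra (with pointwise operations) of continuous functions $f\colon\mathbb{R}^n\to\mathbb{R}$ of polynomial growth, i.e. for which there exist $N\in\mathbb{N}$ and $M\in[0,\infty)$ with $|f|\le M(\mathbf{1}+|\pi_1|+\cdots+|\pi_n|)^N$. Here $\mathbf{1}$ is the constant function one on $\mathbb{R}^n$ and $\pi_i\colon\mathbb{R}^n\to\mathbb{R}$ is the $i$-th coordinate projection. A lattice-ordered algebra $X$ with identity $1_X$ admits a polynomial growth continuous function calculus if, for each $n\in\mathbb{N}$ and each $\bm{x}=(x_1,\ldots,x_n)\in X^n$, there is a lattice-algebra homomorphism $\Psi_{\bm{x}}\colon PG_n\to X$ satisfying $\Psi_{\bm{x}}(\mathbf{1})=1_X$ and $\Psi_{\bm{x}}(\pi_i)=x_i$ for $i=1,\ldots,n$. *)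

(* Defs.v *)
From HB Require Import structures.
From mathcomp Require Import all_boot all_order all_algebra.
From mathcomp Require Import all_classical all_reals all_analysis.

Set Implicit Arguments.
Unset Strict Implicit.
Unset Printing Implicit Defensive.

Import Order.TTheory GRing.Theory Num.Theory.
Import numFieldNormedType.Exports.

Local Open Scope classical_set_scope.
Local Open Scope ring_scope.

(* Real lattice-ordered algebras with identity. They are packed by hand because
   a Hierarchy Builder structure inheriting from both ring and order structures
   would lack a join with [Num.NumDomain]; [algType R] is not used for the
   algebra part since it would exclude the algebra {0}. Neither commutativity
   nor positivity of the identity is assumed. The library structures are
   declared on [latalg_sort] below, with the order in [ring_display]. *)
Record latticeAlg (R : realType) := LatticeAlg {
  latalg_lmod : lmodType R;
  latalg_le : rel latalg_lmod;
  latalg_meet : latalg_lmod -> latalg_lmod -> latalg_lmod;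
  latalg_join : latalg_lmod -> latalg_lmod -> latalg_lmod;
  latalg_mul : latalg_lmod -> latalg_lmod -> latalg_lmod;
  latalg_one : latalg_lmod;
  latalg_le_refl : reflexive latalg_le;
  latalg_le_anti : antisymmetric latalg_le;
  latalg_le_trans : transitive latalg_le;
  latalg_meetP : forall x y z,
    latalg_le x (latalg_meet y z) = latalg_le x y && latalg_le x z;
  latalg_joinP : forall x y z,
    latalg_le (latalg_join x y) z = latalg_le x z && latalg_le y z;
  latalg_leD2r : forall z x y, latalg_le x y -> latalg_le (x + z) (y + z);
  latalg_scale_ge0 : forall (a : R) x,
    0 <= a -> latalg_le 0 x -> latalg_le 0 (a *: x);
  latalg_mulA : associative latalg_mul;
  latalg_mul1x : left_id latalg_one latalg_mul;
  latalg_mulx1 : right_id latalg_one latalg_mul;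
  latalg_mulDl : left_distributive latalg_mul +%R;
  latalg_mulDr : right_distributive latalg_mul +%R;
  latalg_scaleAl : forall (a : R) x y,
    a *: latalg_mul x y = latalg_mul (a *: x) y;
  latalg_scaleAr : forall (a : R) x y,
    a *: latalg_mul x y = latalg_mul x (a *: y);
  latalg_mul_ge0 : forall x y,
    latalg_le 0 x -> latalg_le 0 y -> latalg_le 0 (latalg_mul x y)
}.

Definition latalg_sort (R : realType) (X : latticeAlg R) : Type :=
  latalg_lmod X.
Coercion latalg_sort : latticeAlg >-> Sortclass.

HB.instance Definition _ (R : realType) (X : latticeAlg R) :=
  GRing.Lmodule.copy (latalg_sort X) (latalg_lmod X).
HB.instance Definition _ (R : realType) (X : latticeAlg R) :=
  GRing.Zmodule_isPzRing.Build (latalg_sort X) (@latalg_mulA R X)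
    (@latalg_mul1x R X) (@latalg_mulx1 R X) (@latalg_mulDl R X)
    (@latalg_mulDr R X).
HB.instance Definition _ (R : realType) (X : latticeAlg R) :=
  Order.Le_isPOrder.Build ring_display (latalg_sort X) (@latalg_le_refl R X)
    (@latalg_le_anti R X) (@latalg_le_trans R X).
HB.instance Definition _ (R : realType) (X : latticeAlg R) :=
  Order.POrder_MeetJoin_isLattice.Build ring_display (latalg_sort X)
    (@latalg_meetP R X) (@latalg_joinP R X).

Section LatticeAlgNotions.
Variables (R : realType) (V : latticeAlg R).
Implicit Types (x y e : V) (A : set V).

Definition archimedean_vlattice : Prop :=
  forall x y, 0 <= x -> (forall k : nat, x *+ k <= y) -> x = 0.

Definition vabs x : V := (x `|` - x)%O.

Definition is_subspace A : Prop :=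
  A 0 /\ forall (a : R) x y, A x -> A y -> A (a *: x + y).

Definition is_order_ideal A : Prop :=
  is_subspace A /\ forall x y, A y -> vabs x <= vabs y -> A x.

Definition is_vector_sublattice A : Prop :=
  is_subspace A /\
  forall x y, A x -> A y -> A (x `&` y)%O /\ A (x `|` y)%O.

Definition order_ideal e : set V := smallest is_order_ideal [set e].

Definition ideal_norm e x : R :=
  inf [set l : R | 0 <= l /\ vabs x <= l *: e].

Definition norm_closed e A : Prop :=
  forall x, order_ideal e x ->
    (forall eps : R, 0 < eps -> exists2 a, A a & ideal_norm e (x - a) < eps) ->
    A x.

Definition closed_sublattice e A : set V :=
  smallest [set B | [/\ is_vector_sublattice B, B `<=` order_ideal e
                      & norm_closed e B]] A.

Definition norm_cauchy e (u : nat -> V) : Prop :=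
  forall eps : R, 0 < eps -> exists N : nat,
    forall i j : nat, (N <= i)%N -> (N <= j)%N ->
      ideal_norm e (u i - u j) < eps.

Definition norm_complete e A : Prop :=
  forall u : nat -> V, (forall k, A (u k)) -> norm_cauchy e u ->
    exists2 x, A x & (fun k => ideal_norm e (u k - x)) @ \oo --> (0 : R).

Lemma latalg_ge0 x : (0 <= x) = latalg_le 0 x. Proof. by []. Qed.

Lemma latalg_leD x y z t : x <= y -> z <= t -> x + z <= y + t.
Proof.
move=> xy zt; apply: (le_trans (latalg_leD2r z xy : x + z <= y + z)).
by rewrite ![y + _]addrC; exact: latalg_leD2r.
Qed.

Lemma latalg_subr_ge0 x y : (0 <= y - x) = (x <= y).
Proof.
apply/idP/idP => h.
  by have := latalg_leD2r x h; rewrite add0r subrK.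
by have := latalg_leD2r (- x) h; rewrite subrr.
Qed.

Lemma latalg_leZ (a : R) x y : 0 <= a -> x <= y -> a *: x <= a *: y.
Proof.
move=> a0 xy; rewrite -latalg_subr_ge0 -scalerBr.
by apply: latalg_scale_ge0 => //; rewrite -latalg_ge0 latalg_subr_ge0.
Qed.

Lemma vabs_le x c : (vabs x <= c) = (x <= c) && (- x <= c).
Proof. exact: leUx. Qed.

Lemma vabs_ge0 x : 0 <= vabs x.
Proof.
have /andP[h1 h2] : (x <= vabs x) && (- x <= vabs x) by rewrite -vabs_le.
have := latalg_leD h1 h2; rewrite subrr => h.
have h2' : 0 <= (2^-1 : R) by rewrite invr_ge0.
have := latalg_leZ h2' h; rewrite scaler0 -{1 2}[vabs x]scale1r -scalerDl scalerA.
by rewrite mulVf ?scale1r// -[1 + 1]/(2%:R) pnatr_eq0.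
Qed.

Lemma vabs_id x : 0 <= x -> vabs x = x.
Proof.
move=> x0; apply/eqP; rewrite eq_le vabs_le lexx /=.
have : vabs x <= vabs x by [].
rewrite {1}vabs_le => /andP[-> _]; rewrite andbT; apply: (le_trans _ x0).
by rewrite -latalg_subr_ge0 sub0r opprK.
Qed.

Lemma order_idealE e : 0 <= e ->
  order_ideal e = [set x | exists2 l : R, 0 <= l & vabs x <= l *: e].
Proof.
move=> e0; apply/seteqP; split=> [x|x [l l0 xl] A [[[A0 Alin] Asol] Ae]].
  apply; split; last by move=> _ ->; exists 1; rewrite // scale1r vabs_id.
  split; [split|].
  - by exists 0 => //; rewrite scale0r vabs_id.
  - move=> a u v [l l0 ul] [k k0 vk].
    exists (`|a| * l + k); first by rewrite addr_ge0 ?mulr_ge0.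
    move: ul vk; rewrite !vabs_le => /andP[u1 u2] /andP[v1 v2].
    rewrite scalerDl -scalerA opprD.
    have [a0|a0] := leP 0 a.
      rewrite (ger0_norm a0) -scalerN; apply/andP.
      by split; apply: latalg_leD => //; apply: latalg_leZ.
    have na : 0 <= - a by rewrite oppr_ge0 ltW.
    have E : a *: u = - a *: - u by rewrite scalerN scaleNr opprK.
    rewrite (ltr0_norm a0) -[- (a *: u)]scaleNr E; apply/andP.
    by split; apply: latalg_leD => //; apply: latalg_leZ.
  - move=> u v [l l0 vl] uv; exists l => //; exact: le_trans vl.
apply: (Asol _ (l *: e)).
  by have := Alin l e 0 (Ae e erefl) A0; rewrite addr0.
by rewrite (vabs_id (latalg_scale_ge0 l0 e0)).
Qed.
End LatticeAlgNotions.

Arguments archimedean_vlattice {R} V.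

Definition is_f_algebra (R : realType) (A : latticeAlg R) : Prop :=
  forall x y z : A, (x `&` y)%O = 0 -> 0 <= z ->
    ((z * x) `&` y)%O = 0 /\ ((x * z) `&` y)%O = 0.

Arguments is_f_algebra {R} A.

(* Preservation of the identities is not part of the notion. *)
Definition is_lattice_algebra_hom (R : realType) (A B : latticeAlg R)
    (h : A -> B) : Prop :=
  [/\ linear h, {morph h : x y / x * y},
      {morph h : x y / (x `&` y)%O} & {morph h : x y / (x `|` y)%O}].

Definition polynomial_growth (R : realType) n (f : 'rV[R]_n -> R) : Prop :=
  exists N : nat, (0 < N)%N /\ exists M : R, 0 <= M /\
    forall t, `|f t| <= M * (1 + \sum_(i < n) `|t ord0 i|) ^+ N.

Definition PG_pred (R : realType) n : pred ('rV[R]_n -> R) :=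
  fun f => `[< continuous f /\ polynomial_growth f >].

Record PG (R : realType) (n : nat) := MkPG {
  PG_fun :> 'rV[R]_n -> R;
  PG_funP : PG_fun \in @PG_pred R n
}.
Arguments MkPG {R n} PG_fun PG_funP.

HB.instance Definition _ (R : realType) n := [isSub for @PG_fun R n].
HB.instance Definition _ (R : realType) n := [Choice of PG R n by <:].

Section PGstructure.
Variables (R : realType) (n : nat).
Implicit Types (f g : 'rV[R]_n -> R).

Let w (t : 'rV[R]_n) : R := 1 + \sum_(i < n) `|t ord0 i|.

Lemma PG_weight_ge1 (t : 'rV[R]_n) : 1 <= 1 + \sum_(i < n) `|t ord0 i|.
Proof. by rewrite lerDl sumr_ge0. Qed.

Lemma inPG f : (f \in @PG_pred R n) <-> continuous f /\ polynomial_growth f.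
Proof. by rewrite unfold_in; split=> [/asboolP|?]; last exact/asboolP. Qed.

Lemma PG_intro f (N : nat) (M : R) : continuous f ->
  (forall t, `|f t| <= M * w t ^+ N) -> f \in @PG_pred R n.
Proof.
move=> cf gf; apply/inPG; split=> //.
have w1 t : 1 <= w t by exact: PG_weight_ge1.
exists N.+1; split=> //; exists `|M|; split=> // t.
apply: (le_trans (gf t)); apply: (@le_trans _ _ (`|M| * w t ^+ N)).
  by apply: ler_wpM2r; rewrite ?exprn_ge0 ?ler_norm// (le_trans ler01).
by apply: ler_wpM2l => //; apply: ler_weXn2l.
Qed.

Lemma PG_bound f : f \in @PG_pred R n ->
  exists N : nat, exists M : R, 0 <= M /\ forall k, (N <= k)%N ->
    forall t, `|f t| <= M * w t ^+ k.
Proof.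
move=> /inPG[_ [N [_ [M [M0 fM]]]]]; exists N, M; split=> // k Nk t.
apply: (le_trans (fM t)); apply: ler_wpM2l => //.
by apply: ler_weXn2l => //; exact: PG_weight_ge1.
Qed.

Lemma PG_cont f : f \in @PG_pred R n -> continuous f.
Proof. by move=> /inPG[]. Qed.

Lemma PG_cst (c : R) : (cst c : 'rV[R]_n -> R) \in @PG_pred R n.
Proof.
apply: (@PG_intro _ 0%N `|c|); first exact: cst_continuous.
move=> t.
by rewrite expr0 mulr1.
Qed.

Lemma PG_add2 f g (h : 'rV[R]_n -> R) :
  f \in @PG_pred R n -> g \in @PG_pred R n -> continuous h ->
  (forall t, `|h t| <= `|f t| + `|g t|) -> h \in @PG_pred R n.
Proof.
move=> Pf Pg ch hfg.
have [Nf [Mf [_ Hf]]] := PG_bound Pf; have [Ng [Mg [_ Hg]]] := PG_bound Pg.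
apply: (@PG_intro _ (maxn Nf Ng) (Mf + Mg)) => // t.
by rewrite (le_trans (hfg t))// mulrDl lerD ?Hf ?Hg ?leq_maxl ?leq_maxr.
Qed.

Lemma PG_subring : subring_closed (@PG_pred R n).
Proof.
split=> [|f g Pf Pg|f g Pf Pg]; first exact: PG_cst.
- apply: (PG_add2 Pf Pg) => [t|t]; last exact: ler_normB.
  exact: (cvgB (PG_cont Pf (x:=t)) (PG_cont Pg (x:=t))).
- have [Nf [Mf [Mf0 Hf]]] := PG_bound Pf; have [Ng [Mg [Mg0 Hg]]] := PG_bound Pg.
  apply: (@PG_intro _ (Nf + Ng)%N (Mf * Mg)) => [t|t].
    exact: (cvgM (PG_cont Pf (x:=t)) (PG_cont Pg (x:=t))).
  by rewrite normrM exprD mulrACA ler_pM ?Hf ?Hg.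
Qed.

Lemma PG_meet : meet_closed (@PG_pred R n).
Proof.
move=> f g Pf Pg.
have -> : (f `&` g)%O = f \min g by apply/funext => t; exact: meetEtotal.
apply: (PG_add2 Pf Pg) => [t|t].
  exact: (@continuous_min _ _ f g t (PG_cont Pf (x:=t)) (PG_cont Pg (x:=t))).
by rewrite /= /Order.min; case: ifP => _; rewrite ?lerDl ?lerDr.
Qed.

Lemma PG_join : join_closed (@PG_pred R n).
Proof.
move=> f g Pf Pg.
have -> : (f `|` g)%O = f \max g by apply/funext => t; exact: joinEtotal.
apply: (PG_add2 Pf Pg) => [t|t].
  exact: (@continuous_max _ _ f g t (PG_cont Pf (x:=t)) (PG_cont Pg (x:=t))).
by rewrite /= /Order.max; case: ifP => _; rewrite ?lerDl ?lerDr.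
Qed.

End PGstructure.

HB.instance Definition _ (R : realType) n :=
  GRing.SubChoice_isSubPzRing.Build _ _ (PG R n) (@PG_subring R n).

HB.instance Definition _ (R : realType) n :=
  Order.SubChoice_isSubLattice.Build _ _ _ ring_display (PG R n)
    (@PG_meet R n) (@PG_join R n).

Section PGLattice.
Variables (R : realType) (n : nat).
Implicit Types (a b : R) (f g h : PG R n) (t : 'rV[R]_n).

Lemma PG_scaleP a f : (fun t => a * f t) \in @PG_pred R n.
Proof. by have [_ _] := @PG_subring R n; apply; [exact: PG_cst|exact: PG_funP]. Qed.

Definition PG_scale a f : PG R n := MkPG (fun t => a * f t) (PG_scaleP a f).

Lemma PG_ext f g : (forall t, f t = g t) -> f = g.
Proof. by move=> fg; apply: val_inj; apply/funext. Qed.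

Fact PG_scalerA a b f : PG_scale a (PG_scale b f) = PG_scale (a * b) f.
Proof. by apply: PG_ext => t /=; rewrite mulrA. Qed.
Fact PG_scale1r : left_id 1 PG_scale.
Proof. by move=> f; apply: PG_ext => t /=; rewrite mul1r. Qed.
Fact PG_scalerDr : right_distributive PG_scale +%R.
Proof. by move=> a f g; apply: PG_ext => t; rewrite /= mulrDr. Qed.
Fact PG_scalerDl f : {morph PG_scale^~ f : a b / a + b}.
Proof. by move=> a b; apply: PG_ext => t /=; rewrite mulrDl. Qed.

HB.instance Definition _ := GRing.Zmodule_isLmodule.Build R (PG R n)
  PG_scalerA PG_scale1r PG_scalerDr PG_scalerDl.

Lemma PG_addE f g t : (f + g) t = f t + g t. Proof. by []. Qed.
Lemma PG_oppE f t : (- f) t = - f t. Proof. by []. Qed.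
Lemma PG_zeroE t : (0 : PG R n) t = 0. Proof. by []. Qed.
Lemma PG_oneE t : (1 : PG R n) t = 1. Proof. by []. Qed.
Lemma PG_mulE f g t : (f * g) t = f t * g t. Proof. by []. Qed.
Lemma PG_scaleE a f t : (a *: f) t = a * f t. Proof. by []. Qed.
Lemma PG_meetE f g t : (f `&` g)%O t = Num.min (f t) (g t).
Proof. exact: meetEtotal. Qed.
Lemma PG_joinE f g t : (f `|` g)%O t = Num.max (f t) (g t).
Proof. exact: joinEtotal. Qed.
Lemma PG_leP f g : reflect (forall t, f t <= g t) (f <= g).
Proof. by rewrite -Order.le_val; exact: asboolP. Qed.

Fact PG_leD2r h f g : f <= g -> f + h <= g + h.
Proof. by move=> /PG_leP fg; apply/PG_leP => t; rewrite !PG_addE lerD2r. Qed.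

Fact PG_scale_ge0 a f : 0 <= a -> 0 <= f -> 0 <= a *: f.
Proof.
by move=> a0 /PG_leP f0; apply/PG_leP => t; exact: (mulr_ge0 a0 (f0 t)).
Qed.

Fact PG_scaleAl a f g : a *: (f * g) = (a *: f) * g.
Proof. by apply: PG_ext => t; rewrite !(PG_scaleE, PG_mulE) mulrA. Qed.
Fact PG_scaleAr a f g : a *: (f * g) = f * (a *: g).
Proof. by apply: PG_ext => t; rewrite !(PG_scaleE, PG_mulE) mulrCA. Qed.
Fact PG_mul_ge0 f g : 0 <= f -> 0 <= g -> 0 <= f * g.
Proof.
move=> /PG_leP f0 /PG_leP g0; apply/PG_leP => t.
exact: (mulr_ge0 (f0 t) (g0 t)).
Qed.

Definition PG_latticeAlg : latticeAlg R :=
  @LatticeAlg R (PG R n) <=%R Order.meet Order.join *%R 1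
    le_refl le_anti le_trans (@lexI _ _) (@leUx _ _) PG_leD2r PG_scale_ge0
    (@mulrA _) (@mul1r _) (@mulr1 _) (@mulrDl _) (@mulrDr _)
    PG_scaleAl PG_scaleAr PG_mul_ge0.

Lemma PG_projP (i : 'I_n) : (fun t : 'rV[R]_n => t ord0 i) \in @PG_pred R n.
Proof.
apply: (@PG_intro _ _ _ 1 1); first exact: coord_continuous.
move=> t; rewrite mul1r expr1 (bigD1 i)//= addrCA lerDl.
by rewrite addr_ge0 ?sumr_ge0.
Qed.

Definition PG_proj (i : 'I_n) : PG R n := MkPG (fun t => t ord0 i) (PG_projP i).

End PGLattice.

Lemma PG_compP (R : realType) (m n : nat) (g : PG R m) (fs : 'I_m -> PG R n) :
  (fun t => g (\row_(i < m) fs i t)) \in @PG_pred R n.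
Proof.
have cr : continuous (fun t : 'rV[R]_n => \row_(i < m) fs i t : 'rV[R]_m).
  move=> t A [P Pt PA].
  suff : \forall s \near t, forall i, P ord0 i (fs i s).
    by apply: filterS => s Ps; apply: PA => k i; rewrite mxE ord1; exact: Ps.
  have Ft : Filter (nbhs (t : 'rV[R]_n)) by exact: nbhs_filter.
  apply: (@filter_forall _ _ (fun i s => P ord0 i (fs i s)) _ Ft) => i.
  by apply: (PG_cont (PG_funP (fs i)) (x:=t)); have := Pt ord0 i; rewrite mxE.
have [N [M [M0 gM]]] := PG_bound (PG_funP g).
have /choice[D /choice[K DK]] : forall i, exists D : nat, exists K : R,
    0 <= K /\ forall k, (D <= k)%N -> forall t,
      `|fs i t| <= K * (1 + \sum_(j < n) `|t ord0 j|) ^+ k.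
  by move=> i; exact: PG_bound (PG_funP (fs i)).
pose d := \max_(i < m) D i.
apply: (@PG_intro _ _ _ (d * N)%N (M * (1 + \sum_(i < m) K i) ^+ N)).
  by move=> t; exact: (continuous_comp (cr t) (PG_cont (PG_funP g) (x:=_))).
move=> t; apply: (le_trans (gM N (leqnn N) _)).
rewrite -mulrA ler_wpM2l// exprM -exprMn lerXn2r ?nnegrE//.
- by rewrite addr_ge0 ?sumr_ge0.
- rewrite mulr_ge0 ?exprn_ge0 ?addr_ge0 ?sumr_ge0// => i _.
  by have [] := DK i.
- rewrite mulrDl mul1r lerD//.
    by rewrite exprn_ege1// PG_weight_ge1.
  rewrite mulr_suml ler_sum// => i _; rewrite mxE.
  by have [_ ->//] := DK i; exact: leq_bigmax.
Qed.

Definition PG_comp (R : realType) (m n : nat) (g : PG R m)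
    (fs : 'I_m -> PG R n) : PG R n :=
  MkPG (fun t => g (\row_(i < m) fs i t)) (PG_compP g fs).

Definition is_PG_calculus_at (R : realType) (X : latticeAlg R) (n : nat)
    (x : 'I_n -> X) (Psi : PG R n -> X) : Prop :=
  [/\ @is_lattice_algebra_hom R (PG_latticeAlg R n) X Psi, Psi 1 = 1
    & forall i : 'I_n, Psi (PG_proj R i) = x i].

Definition admits_PG_calculus (R : realType) (X : latticeAlg R) : Prop :=
  forall n : nat, (0 < n)%N -> forall x : 'I_n -> X,
    exists Psi : PG R n -> X, is_PG_calculus_at x Psi.

Arguments admits_PG_calculus {R} X.

(* Main.v *)
Require Import Defs.
From mathcomp Require Import all_boot all_order all_algebra.
From mathcomp Require Import all_classical all_reals all_analysis.
From mathcomp Require Import ring lra.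

Set Implicit Arguments.
Unset Strict Implicit.
Unset Printing Implicit Defensive.

Import Order.TTheory GRing.Theory Num.Theory.
Import numFieldNormedType.Exports.

Local Open Scope classical_set_scope.
Local Open Scope ring_scope.

(** The idea is to represent the elements of an Archimedean [f]-algebra that are
    bounded by multiples of powers of some [f >= 1] as real-valued functions. A prime cone [Q] is a total
    preorder on [X] compatible with its operations; Zorn's lemma provides one
    that puts any given element not below 0 on the nonnegative side
    ([prime_cone_separation]). On the elements that are bounded by reals with
    respect to [Q], the standard part [st Q] is a homomorphism to the reals of
    lattices and algebras. By [st_separation], an inequality between elements
    bounded by multiples of powers of [f] can be checked on the real numbers
    [st Q _], with [Q] ranging over the cones for which [f] is bounded: if
    [y <= C f^k] then an inequality [y >= e f^(k+1)] at [Q] bounds [f] there, and the Archimedean property lets [e] tend to 0.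

    Uniqueness: for a calculus [Psi] at [x], the composite [st Q \o Psi] is a
    unital real homomorphism on functions of polynomial growth, so that it is
    the evaluation at the point with coordinates [st Q (x i)] ([calc_eval]).
    Hence the standard parts of [Psi h] depend on [x] and [h] only, and
    separation concludes. The composition formula is uniqueness applied to
    [g |-> Psi_x (g \o fs)].

    Necessity: every disjoint pair in [X] is the image of a disjoint pair of
    functions, so that [X] is an [f]-algebra. With [f] the image of the
    weight [w = 1 + sum |t_i|], a sequence in the image of [Psi] which is Cauchy
    for the norm of [f^m] lifts, after truncation of its increments, to a
    uniformly convergent sequence of functions ([uniform_lift]); so the
    part of the image lying in the ideal of [f^m] is complete, and the closed
    sublattice is a closed subset of it.

    Sufficiency: a function [h] bounded by [M w^N] is a limit, uniformly in the
    weight [w^(N+1)], of lattice combinations of affine functions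
    ([weighted_lattice_approximation]). Their values at [x] lie in the sublattice
    generated by 1 and the [x i], form a Cauchy sequence for the norm of
    [f^(N+1)] by separation, and the limit has standard part [h (st Q x)] for all
    [Q]. Separation makes it unique, and turns the pointwise laws into the
    homomorphism laws of [h |-> h(x)]. *)

(** * Vector lattices *)

Section VectorLattice.
Variables (R : realType) (X : latticeAlg R).
Implicit Types (x y z u v m : X) (a : R).

Lemma vl_leD2r z x y : (x + z <= y + z) = (x <= y).
Proof.
apply/idP/idP => [h|]; last exact: latalg_leD2r.
by have := @latalg_leD2r R X (- z) _ _ h; rewrite !addrK.
Qed.

Lemma vl_leBl x y z : (x - y <= z) = (x <= z + y).
Proof. by rewrite -[RHS](vl_leD2r (- y)) addrK. Qed.

Lemma vl_leBr x y z : (x <= y - z) = (x + z <= y).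
Proof. by rewrite -[LHS](vl_leD2r z) subrK. Qed.

Lemma vl_leN2 x y : (- x <= - y) = (y <= x).
Proof. by rewrite -[LHS]latalg_subr_ge0 opprK addrC latalg_subr_ge0. Qed.

Lemma vl_addr_ge0 x y : 0 <= x -> 0 <= y -> 0 <= x + y.
Proof. by move=> x0 y0; rewrite -[0 in X in X <= _]addr0 latalg_leD. Qed.

Lemma vl_joinDr z x y : ((x `|` y) + z = (x + z) `|` (y + z))%O.
Proof.
apply/eqP; rewrite eq_le leUx !vl_leD2r leUl leUr !andbT.
by rewrite -vl_leBr leUx !vl_leBr leUl leUr.
Qed.

Lemma vl_meetDr z x y : ((x `&` y) + z = (x + z) `&` (y + z))%O.
Proof.
apply/eqP; rewrite eq_le lexI !vl_leD2r leIl leIr /=.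
by rewrite -vl_leBl lexI !vl_leBl leIl leIr.
Qed.

Lemma vl_leNr x y : (x <= - y) = (y <= - x).
Proof. by rewrite -[in LHS](opprK x) vl_leN2. Qed.

Lemma vl_oppU x y : (- (x `|` y) = (- x) `&` (- y))%O.
Proof.
apply/eqP; rewrite eq_le lexI !vl_leN2 leUl leUr /=.
by rewrite vl_leNr leUx !(vl_leNr _ ((- x) `&` (- y))%O) leIl leIr.
Qed.

Lemma vl_oppI x y : (- (x `&` y) = (- x) `|` (- y))%O.
Proof. by rewrite -[x in LHS]opprK -[y in LHS]opprK -vl_oppU opprK. Qed.

Lemma vl_meetU x y : ((x `&` y) = x + y - (x `|` y))%O.
Proof.
rewrite vl_oppU addrC vl_meetDr addKr [x + y]addrC addKr; exact: meetC.
Qed.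

(** The negative part of [x] is [vpos (- x)]. *)
Definition vpos x : X := (x `|` 0)%O.

Lemma vpos_ge0 x : 0 <= vpos x. Proof. exact: leUr. Qed.

Lemma vpos_ge x : x <= vpos x. Proof. exact: leUl. Qed.

Lemma vpos_le x y : 0 <= y -> x <= y -> vpos x <= y.
Proof. by move=> y0 xy; rewrite leUx xy. Qed.

Lemma vpos_id x : 0 <= x -> vpos x = x.
Proof. by move=> x0; apply/eqP; rewrite eq_le vpos_ge vpos_le. Qed.

Lemma vposN_ge0 x : 0 <= x -> vpos (- x) = 0.
Proof.
by move=> x0; apply/eqP; rewrite eq_le vpos_ge0 vpos_le // -oppr0 vl_leN2.
Qed.

Lemma vposB x : vpos x - vpos (- x) = x.
Proof. by rewrite /vpos vl_oppU opprK oppr0 vl_meetU addr0 addrC subrK. Qed.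

Lemma vpos_disjoint x : (vpos x `&` vpos (- x))%O = 0.
Proof.
have E : vpos x = x + vpos (- x) by rewrite -{2}(vposB x) subrK.
rewrite {1}E -{2}[vpos (- x)]add0r -vl_meetDr /vpos -{1}[x]opprK -{1}oppr0.
by rewrite -vl_oppU addNr.
Qed.

(** The form of distributivity that keeps [u + v] disjoint from [m] when [u] and
    [v] are. *)
Lemma meet_subadditive u v m : 0 <= u -> 0 <= v -> 0 <= m ->
  ((u + v) `&` m <= (u `&` m) + (v `&` m))%O.
Proof.
move=> u0 v0 m0; set w := (X in X <= _).
have wm : w <= m by exact: leIr.
have wuv : w <= u + v by exact: leIl.
rewrite -vl_leBl vl_oppI addrC vl_joinDr leUx !lexI.
rewrite ![- _ + w]addrC !vl_leBl wuv.
rewrite (le_trans wm) /=; last by rewrite -{1}[m]addr0 latalg_leD.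
rewrite (le_trans wm) /=; last by rewrite -{1}[m]add0r latalg_leD.
by rewrite (le_trans wm) // -{1}[m]addr0 latalg_leD.
Qed.

Lemma vl_ler_addr x y : 0 <= y -> x <= x + y.
Proof. by move=> y0; rewrite -{1}[x]addr0 latalg_leD. Qed.

Lemma vl_ler_addl x y : 0 <= y -> x <= y + x.
Proof. by rewrite addrC; exact: vl_ler_addr. Qed.

Lemma vabsN x : vabs (- x) = vabs x.
Proof. by rewrite /vabs opprK joinC. Qed.

Lemma vabs_ge x : x <= vabs x. Proof. exact: leUl. Qed.

Lemma vabs_geN x : - x <= vabs x. Proof. exact: leUr. Qed.

Lemma vabsD x y : vabs (x + y) <= vabs x + vabs y.
Proof. by rewrite vabs_le opprD !latalg_leD ?vabs_ge ?vabs_geN. Qed.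

Lemma vabsU x y : vabs (x `|` y)%O <= vabs x + vabs y.
Proof.
have := vl_ler_addr (vabs x) (vabs_ge0 y); have := vl_ler_addl (vabs y) (vabs_ge0 x).
rewrite !vabs_le => /andP[y1 _] /andP[x1 x2].
by rewrite vl_oppU leUx x1 y1 leIxl.
Qed.

Lemma archimedean_le0 x y : archimedean_vlattice X -> 0 <= y ->
  (forall a, 0 < a -> x <= a *: y) -> x <= 0.
Proof.
move=> X_arch y0 H; suff v0 : vpos x = 0 by rewrite -v0 vpos_ge.
apply: (X_arch (vpos x) y (vpos_ge0 x)); case=> [|n]; first by rewrite mulr0n.
have n0 : 0 < n.+1%:R :> R by rewrite ltr0n.
have -> : y = n.+1%:R *: (n.+1%:R^-1 *: y).
  by rewrite scalerA mulfV ?scale1r // lt0r_neq0.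
rewrite -[_ *+ n.+1]scaler_nat; apply: latalg_leZ; first exact: ltW.
apply: vpos_le; last by apply: H; rewrite invr_gt0.
by apply: latalg_scale_ge0 => //; rewrite invr_ge0 ltW.
Qed.

End VectorLattice.

(** * Disjointness and the identity in f-algebras *)

Section FAlgebra.
Variables (R : realType) (X : latticeAlg R).
Hypothesis X_f : is_f_algebra X.
Implicit Types (x y z u v m : X).

(** Multiplying the two members in turn keeps them disjoint, until [u * v] is
    disjoint from itself. *)
Lemma disjoint_mul u v : 0 <= u -> 0 <= v -> (u `&` v)%O = 0 -> u * v = 0.
Proof.
move=> u0 v0 uv; have [_ uv_v] := X_f uv v0.
rewrite meetC in uv_v; have [uv_uv _] := X_f uv_v u0.
by rewrite meetxx in uv_uv.
Qed.

(** As the parts of 1 have product 0, the negative part [1 * 1^-] equals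
    [- (1^-)^2], which is at most 0. *)
Lemma falg_one_ge0 : 0 <= 1 :> X.
Proof.
have E : vpos (- 1) = - (vpos (- 1) * vpos (- 1)) :> X.
  rewrite -[LHS]mul1r -{1}[1](vposB (1 : X)) mulrBl.
  have -> : vpos 1 * vpos (- 1) = 0 :> X.
    exact: disjoint_mul (vpos_ge0 _) (vpos_ge0 _) (vpos_disjoint _).
  by rewrite sub0r.
suff N0 : vpos (- 1) = 0 :> X by rewrite -[1 : X]vposB N0 subr0 vpos_ge0.
apply/eqP; rewrite eq_le vpos_ge0 andbT E -oppr0 vl_leN2.
by apply: latalg_mul_ge0; exact: vpos_ge0.
Qed.

End FAlgebra.

(** * Prime cones *)

Section PrimeCone.
Variables (R : realType) (X : latticeAlg R).
Implicit Types (x y z u v m : X).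

(** A prime cone is the nonnegative cone of a total preorder on [X], given by
    [x <= y] iff [Q (y - x)], for which the positive elements are nonnegative,
    sums, products and meets of nonnegative elements are nonnegative and [-1]
    is not: it describes a quotient of [X] that is a totally ordered algebra. *)
Record prime_cone (Q : X -> Prop) : Prop := PrimeCone {
  pcone_ge0 : forall x, 0 <= x -> Q x;
  pconeD : forall x y, Q x -> Q y -> Q (x + y);
  pconeM : forall x y, Q x -> Q y -> Q (x * y);
  pconeI : forall x y, Q x -> Q y -> Q (x `&` y)%O;
  pcone_total : forall x, Q x \/ Q (- x);
  pconeN1 : ~ Q (- 1)
}.

Hypothesis X_f : is_f_algebra X.

Section MaximalFamily.
Variables (z : X) (z0 : 0 <= z).

Definition meets (s : seq X) : X := foldr Order.meet z s.

Lemma meets_ge0 s : (forall x, x \in s -> 0 <= x) -> 0 <= meets s.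
Proof.
elim: s => //= x s IHs H; rewrite lexI H ?mem_head // IHs // => y ys.
by rewrite H // in_cons ys orbT.
Qed.

Lemma meets_cat s t : meets (s ++ t) <= meets s /\ meets (s ++ t) <= meets t.
Proof.
elim: s => [|x s [IHs IHt]] /=; last first.
  by split; [rewrite lexI leIl leIxr|rewrite leIxr].
by split => //; elim: t => //= y t IHt; rewrite leIxr.
Qed.

Lemma meets_mem s x : x \in s -> meets s <= x.
Proof.
elim: s => //= y s IHs; rewrite in_cons => /orP[/eqP ->|/IHs h].
  exact: leIl.
by rewrite leIxr.
Qed.

Lemma meets_sub s t : {subset s <= t} -> meets t <= meets s.
Proof.
elim: s => [_|x s IHs st] /=.
  by elim: t => //= y t IHt; rewrite leIxr.
rewrite lexI meets_mem ?st ?mem_head //= IHs // => y ys.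
by rewrite st // in_cons ys orbT.
Qed.

(** Together with [z], such a [G] generates a proper filter of positive
    elements. *)
Definition centered (G : set X) :=
  (forall x, G x -> 0 <= x) /\
  forall s, (forall x, x \in s -> G x) -> meets s != 0.

Lemma maximal_centered : z != 0 ->
  exists G, centered G /\ forall H, G `<` H -> ~ centered H.
Proof.
move=> zn0; apply: (@Zorn_bigcup X centered) => F Fc Ftot; split.
  by move=> x [G FG Gx]; have [+ _] := Fc G FG; exact.
case=> [_|x0 s sF]; first exact: zn0.
suff [G FG sG] : exists2 G, F G & forall x, x \in x0 :: s -> G x.
  by have [_] := Fc G FG; exact.
elim: s x0 sF => [|y s IHs] x0 sF.
  have [G FG Gx] := sF x0 (mem_head _ _); exists G => // x.
  by rewrite inE => /eqP ->.
have [|G FG sG] := IHs y; first by move=> x xs; apply: sF; rewrite in_cons xs orbT.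
have [H FH Hx] := sF x0 (mem_head _ _).
have [GH|HG] := Ftot G H FG FH; [exists H|exists G] => // x.
  by rewrite in_cons => /orP[/eqP -> //|/sG /GH].
by rewrite in_cons => /orP[/eqP ->|/sG //]; exact: HG.
Qed.

Section Null.
Variables (G : set X) (Gc : centered G) (Gmax : forall H, G `<` H -> ~ centered H).

(** The elements disjoint from a member of the filter generated by [G] and [z]:
    the positive part of a minimal prime ideal, which is stable under
    multiplication because that preserves disjointness in an f-algebra. *)
Definition null u : Prop :=
  0 <= u /\ exists2 s, (forall x, x \in s -> G x) & (u `&` meets s)%O = 0.

Lemma null_le u v : 0 <= u -> u <= v -> null v -> null u.
Proof.
move=> u0 uv [_ [s sG vs]]; split=> //; exists s => //.
have s0 : 0 <= meets s by apply: meets_ge0 => x /sG; have [+ _] := Gc; exact.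
by apply/eqP; rewrite eq_le lexI u0 s0 -vs leI2.
Qed.

Lemma nullD u v : null u -> null v -> null (u + v).
Proof.
move=> [u0 [s sG us]] [v0 [t tG vt]]; split; first exact: vl_addr_ge0.
have stG x : x \in s ++ t -> G x by rewrite mem_cat => /orP[/sG|/tG].
exists (s ++ t) => //.
have st0 : 0 <= meets (s ++ t).
  by apply: meets_ge0 => x /stG; have [+ _] := Gc; exact.
have [sts stt] := meets_cat s t.
apply/eqP; rewrite eq_le lexI vl_addr_ge0 // st0 /= !andbT.
apply: (le_trans (meet_subadditive u0 v0 st0)).
rewrite -[X in _ <= X]addr0; apply: latalg_leD.
  by rewrite -us leI2.
by rewrite -vt leI2.
Qed.

Lemma null_mull u v : 0 <= v -> null u -> null (v * u).
Proof.
move=> v0 [u0 [s sG us]]; split; first exact: latalg_mul_ge0.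
by exists s => //; have [] := X_f us v0.
Qed.

Lemma null_mulr u v : 0 <= v -> null u -> null (u * v).
Proof.
move=> v0 [u0 [s sG us]]; split; first exact: latalg_mul_ge0.
by exists s => //; have [] := X_f us v0.
Qed.

(** A member [u] of [G] annihilates everything disjoint from it; by maximality,
    [u] outside [G] is disjoint from a finite meet. *)
Lemma null_prime u v : 0 <= u -> 0 <= v -> (u `&` v)%O = 0 -> null u \/ null v.
Proof.
move=> u0 v0 uv; have [Gu|nGu] := pselect (G u).
  right; split=> //; exists [:: u] => [x|/=]; first by rewrite inE => /eqP ->.
  by rewrite meetA (meetC v) uv; apply/meet_idPl.
have [[s sG us]|H] := pselect (exists2 s, (forall x, x \in s -> G x) &
    (u `&` meets s)%O = 0).
  by left; split=> //; exists s.
exfalso; apply: (Gmax (H := [set x | x = u \/ G x])).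
  by split=> [x Gx|sub]; [right|apply: nGu; apply: sub; left].
split=> [x [-> //|]|s sG]; first by have [+ _] := Gc; exact.
apply/negP => /eqP s0; apply: H.
exists [seq x <- s | x != u] => [x|].
  by rewrite mem_filter => /andP[xu /sG[/eqP|//]]; rewrite (negbTE xu).
have t0 : 0 <= meets [seq x <- s | x != u].
  apply: meets_ge0 => x; rewrite mem_filter => /andP[_ /sG[-> //|]].
  by have [+ _] := Gc; exact.
have us : meets (u :: [seq x <- s | x != u]) <= meets s.
  by apply: meets_sub => x xs; rewrite in_cons mem_filter xs andbT orbN.
rewrite s0 in us; apply/eqP; rewrite eq_le [X in _ && X]lexI u0 t0 andbT.
by rewrite andbT.
Qed.

Lemma null_z : ~ null z.
Proof.
move=> [_ [s sG zs]]; have [_ /(_ s sG)/eqP] := Gc; apply.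
rewrite -zs; apply/esym/meet_idPr.
by apply: (@meets_sub [::]).
Qed.

Lemma null0 : null 0.
Proof. by split=> //; exists [::] => //=; apply/meet_idPl. Qed.

(** Nonnegativity modulo the prime ideal of null elements. *)
Lemma prime_cone_null : prime_cone (fun x => null (vpos (- x))).
Proof.
have nullP x y : null y -> - y <= x -> null (vpos (- x)).
  move=> ny yx; apply: (null_le (vpos_ge0 _) _ ny).
  by apply: vpos_le; [have [] := ny|rewrite -vl_leN2 opprK].
have lowN x : - vpos (- x) <= x by rewrite -vl_leN2 opprK vpos_ge.
split.
- by move=> x x0; rewrite vposN_ge0 //; exact: null0.
- move=> x y nx ny; apply: (nullP _ _ (nullD nx ny)).
  by rewrite opprD latalg_leD.
- move=> x y nx ny.
  apply: (nullP _ _ (nullD (null_mulr (vpos_ge0 y) nx) (null_mull (vpos_ge0 x) ny))).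
  have E (p q n k : X) : (p - n) * (q - k) + (n * q + p * k) = p * q + n * k.
    by rewrite mulrBr !mulrBl opprB addrACA !subrK.
  have := E (vpos x) (vpos y) (vpos (- x)) (vpos (- y)); rewrite !vposB => {}E.
  rewrite -latalg_subr_ge0 opprK E.
  by apply: vl_addr_ge0; apply: latalg_mul_ge0; exact: vpos_ge0.
- move=> x y nx ny; apply: (nullP _ _ (nullD nx ny)).
  rewrite lexI; apply/andP; split.
    apply: le_trans (lowN x); rewrite vl_leN2 -{1}[vpos _]addr0 latalg_leD //.
    exact: vpos_ge0.
  apply: le_trans (lowN y); rewrite vl_leN2 -{1}[vpos _]add0r latalg_leD //.
  exact: vpos_ge0.
- move=> x; rewrite opprK; apply: null_prime; try exact: vpos_ge0.
  by rewrite meetC vpos_disjoint.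
- rewrite opprK vpos_id; last exact: falg_one_ge0.
  by move=> n1; apply: null_z; rewrite -[z]mulr1; exact: null_mull.
Qed.

End Null.
End MaximalFamily.

(** Starting from [z = x^+], the negative part of [x] is null while [z], and
    therefore 1, is not. *)
Lemma prime_cone_separation x : ~~ (x <= 0) -> exists Q, prime_cone Q /\ Q x.
Proof.
move=> nx; pose z := vpos x.
have zn0 : z != 0 by apply: contra nx => /eqP <-; exact: vpos_ge.
have [G [Gc Gmax]] := maximal_centered zn0.
exists (fun x => null z G (vpos (- x))); split.
  exact: (prime_cone_null (vpos_ge0 x) Gc Gmax).
split; first exact: vpos_ge0.
by exists [::] => //=; rewrite meetC vpos_disjoint.
Qed.

End PrimeCone.

(** * Standard parts *)

Section StandardPart.
Variables (R : realType) (X : latticeAlg R).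
Hypothesis X_f : is_f_algebra X.
Implicit Types (x y z f p d : X) (a c e : R).
Local Notation idX := (1 : X).

Lemma vl_scalerAl a x y : a *: (x * y) = (a *: x) * y.
Proof. exact: latalg_scaleAl. Qed.

Lemma vl_scalerAr a x y : a *: (x * y) = x * (a *: y).
Proof. exact: latalg_scaleAr. Qed.

(** Nonnegativity of the four factors bounds [x * y] by [p * d], and of those
    for [- y] also from below: two-sided bounds multiply without splitting into
    positive and negative parts. *)
Lemma mul_cross p d x y : (p - x) * (d + y) + (p + x) * (d - y)
  = (p * d - x * y) + (p * d - x * y).
Proof.
rewrite !mulrDl addrACA -mulrDr addrACA subrr addr0 mulNr [- _ + _]addrC -mulrBr.
by rewrite opprD addrACA subrr add0r mulrDr mulrDr !mulrN addrACA.
Qed.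

Section Cone.
Variables (Q : X -> Prop) (Qp : prime_cone Q).

Lemma pconeZ a x : 0 <= a -> Q x -> Q (a *: x).
Proof.
move=> a0 Qx; rewrite -[x]mul1r vl_scalerAl; apply: (pconeM Qp) => //.
by apply: (pcone_ge0 Qp); apply: latalg_scale_ge0 => //; exact: falg_one_ge0.
Qed.

Lemma pcone_half x : Q (x + x) -> Q x.
Proof.
move=> /(@pconeZ 2^-1); rewrite invr_ge0 ler0n => /(_ isT).
by rewrite -mulr2n -[x *+ 2]scaler_nat scalerA mulVf ?pnatr_eq0 // scale1r.
Qed.

Lemma pcone_scalar a : Q (a *: idX) <-> 0 <= a.
Proof.
split=> [Qa|a0].
  rewrite leNgt; apply/negP => a0; apply: (pconeN1 Qp).
  have := @pconeZ (- a)^-1 _ _ Qa; rewrite invr_ge0 oppr_ge0 ltW // => /(_ isT).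
  by rewrite scalerA invrN mulNr mulVf ?lt_eqF // scaleN1r.
by apply: pconeZ => //; apply: (pcone_ge0 Qp); exact: falg_one_ge0.
Qed.

Lemma pcone_le x y : x <= y -> Q x -> Q y.
Proof.
move=> xy Qx; rewrite -[y](subrK x); apply: (pconeD Qp) => //.
by apply: (pcone_ge0 Qp); rewrite latalg_subr_ge0.
Qed.

Definition dominated c x : Prop := Q (c *: idX - x) /\ Q (c *: idX + x).

Lemma dominatedM a c x y :
  dominated a x -> dominated c y -> dominated (a * c) (x * y).
Proof.
move=> [x1 x2] [y1 y2].
have cE : (a * c) *: idX = (a *: idX) * (c *: idX).
  by rewrite -vl_scalerAl mul1r scalerA.
split; apply: pcone_half; rewrite cE.
  by rewrite -mul_cross; apply: (pconeD Qp); exact: (pconeM Qp).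
rewrite -[x * y]opprK -mulrN -mul_cross opprK.
by apply: (pconeD Qp); exact: (pconeM Qp).
Qed.

Lemma dominatedD a c x y :
  dominated a x -> dominated c y -> dominated (a + c) (x + y).
Proof.
move=> [x1 x2] [y1 y2]; split; rewrite scalerDl ?opprD addrACA; exact: (pconeD Qp).
Qed.

Lemma dominatedN c x : dominated c x -> dominated c (- x).
Proof. by move=> [x1 x2]; split; rewrite ?opprK. Qed.

Lemma dominatedZ a c x : dominated c x -> dominated (`|a| * c) (a *: x).
Proof.
move=> cx; have [a0|a0] := leP 0 a.
  rewrite ger0_norm //; case: cx => x1 x2.
  by split; rewrite -scalerA -?scalerBr -?scalerDr; exact: pconeZ.
rewrite ltr0_norm //; case: cx => x1 x2.
have -> : a *: x = - (- a *: x) by rewrite scaleNr opprK.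
have na : 0 <= - a by rewrite oppr_ge0 ltW.
by split; rewrite ?opprK -scalerA -?scalerBr -?scalerDr; exact: pconeZ.
Qed.

Lemma dominated_scalar c : dominated `|c| (c *: idX).
Proof.
by split; rewrite -?scalerBl -?scalerDl; apply/pcone_scalar;
  [have := ler_norm c|have := ler_norm (- c); rewrite normrN]; lra.
Qed.

Definition infinitesimal x : Prop := forall e, 0 < e -> dominated e x.

Definition finite x : Prop := exists2 c, 0 < c & dominated c x.

Lemma infinitesimalD x y :
  infinitesimal x -> infinitesimal y -> infinitesimal (x + y).
Proof.
move=> ix iy e e0; rewrite (splitr e).
by apply: dominatedD; [apply: ix|apply: iy]; lra.
Qed.

Lemma infinitesimalN x : infinitesimal x -> infinitesimal (- x).
Proof. by move=> ix e e0; apply: dominatedN; exact: ix. Qed.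

Lemma infinitesimal_scalar c : infinitesimal (c *: idX) -> c = 0.
Proof.
move=> ic; apply/eqP; rewrite -normr_eq0 -[_ == _]negbK; apply/negP => c0.
have {}c0 : 0 < `|c| by rewrite lt_neqAle eq_sym c0 normr_ge0.
have [] := ic (`|c| / 2); first lra.
rewrite -scalerBl -scalerDl => /pcone_scalar h1 /pcone_scalar h2.
have [c1|c1] := leP 0 c; [rewrite ger0_norm // in c0 h1 h2|rewrite ltr0_norm // in c0 h1 h2];
lra.
Qed.

Lemma infinitesimalM x y : infinitesimal x -> finite y ->
  infinitesimal (x * y) /\ infinitesimal (y * x).
Proof.
move=> ix [c c0 cy]; split=> e e0.
  by rewrite -(divfK (lt0r_neq0 c0) e); apply: dominatedM => //; apply: ix; rewrite divr_gt0.
rewrite -(divfK (lt0r_neq0 c0) e) mulrC.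
by apply: dominatedM => //; apply: ix; rewrite divr_gt0.
Qed.

Lemma finite_dominated c x : dominated c x -> finite x.
Proof.
move=> [x1 x2]; exists (`|c| + 1); first by rewrite ltr_wpDl.
have Qd : Q ((`|c| + 1 - c) *: idX) by apply/pcone_scalar; have := ler_norm c; lra.
by split; rewrite -[`|c| + 1](subrK c) scalerDl -addrA; exact: (pconeD Qp).
Qed.

Lemma finiteD x y : finite x -> finite y -> finite (x + y).
Proof. by move=> [a _ ax] [c _ cy]; exact: finite_dominated (dominatedD ax cy). Qed.

Lemma finiteN x : finite x -> finite (- x).
Proof. by move=> [c c0 cx]; exists c => //; exact: dominatedN. Qed.

Lemma finiteM x y : finite x -> finite y -> finite (x * y).
Proof. by move=> [a _ ax] [c _ cy]; exact: finite_dominated (dominatedM ax cy). Qed.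

Lemma finiteZ a x : finite x -> finite (a *: x).
Proof. by move=> [c _ cx]; exact: finite_dominated (dominatedZ a cx). Qed.

Lemma finite_scalar c : finite (c *: idX).
Proof. exact: finite_dominated (dominated_scalar c). Qed.

Lemma finite1 : finite 1.
Proof. by rewrite -[1 : X]scale1r; exact: finite_scalar. Qed.

Lemma finiteX x k : finite x -> finite (x ^+ k).
Proof.
move=> fx; elim: k => [|k IHk]; first exact: finite1.
by rewrite exprS; exact: finiteM.
Qed.

Lemma finite_le x y : vabs x <= y -> finite y -> finite x.
Proof.
rewrite vabs_le => /andP[xy nxy] [c _ [y1 y2]]; apply: (@finite_dominated c).
split; [apply: pcone_le y1|apply: pcone_le y1]; rewrite latalg_leD //.
  by rewrite vl_leN2.
by rewrite -[x]opprK vl_leN2.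
Qed.

Lemma finite_vabs x : finite x -> finite (vabs x).
Proof.
move=> [c _ [x1 x2]]; apply: (@finite_dominated c); split.
  rewrite addrC vl_oppU vl_meetDr opprK; apply: (pconeI Qp) => //; by rewrite addrC.
by apply: pcone_le x2; rewrite latalg_leD // leUl.
Qed.

(** For an infinite [x] this is the default value 0. *)
Definition st x : R := xget 0 [set r | infinitesimal (x - r *: idX)].

Lemma st_unique x r : infinitesimal (x - r *: idX) -> st x = r.
Proof.
move=> xr; have := xgetI 0 (xr : [set r | infinitesimal (x - r *: idX)] r).
rewrite -/(st x) /= => xs; apply/eqP; rewrite -subr_eq0; apply/eqP.
apply: infinitesimal_scalar; rewrite scalerBl.
have := infinitesimalD xr (infinitesimalN xs).
by rewrite opprB addrC addrA subrK.
Qed.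

(** The standard part of a finite [x] is the cut it defines in the reals. *)
Lemma st_infinitesimal x : finite x -> infinitesimal (x - st x *: idX).
Proof.
move=> [c c0 [x1 x2]].
pose S := [set r | Q (x - r *: idX)].
have hS : has_sup S.
  split; first by exists (- c); rewrite /S /= scaleNr opprK addrC.
  exists c => r Sr; rewrite -subr_ge0; apply/pcone_scalar; rewrite scalerBl.
  by have := pconeD Qp x1 Sr; rewrite addrA subrK.
suff ix : infinitesimal (x - sup S *: idX) by rewrite (st_unique ix).
move=> e e0; split.
  have [//|] := pcone_total Qp (e *: idX - (x - sup S *: idX)).
  rewrite opprB -addrA -opprD -scalerDl => Se.
  have := ub_le_sup (proj2 hS) Se; lra.
have [r Sr rs] := sup_adherent e0 hS.
have Qd : Q ((e - sup S + r) *: idX) by apply/pcone_scalar; lra.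
have := pconeD Qp Qd Sr.
by rewrite !scalerDl scaleNr addrACA subrr addr0 -addrA [- _ + _]addrC.
Qed.

Lemma stD x y : finite x -> finite y -> st (x + y) = st x + st y.
Proof.
move=> /st_infinitesimal ix /st_infinitesimal iy; apply: st_unique.
by rewrite scalerDl opprD addrACA; exact: infinitesimalD.
Qed.

Lemma stN x : finite x -> st (- x) = - st x.
Proof.
move=> /st_infinitesimal ix; apply: st_unique.
by rewrite scaleNr -opprD; exact: infinitesimalN.
Qed.

Lemma st_scalar c : st (c *: idX) = c.
Proof.
apply: st_unique => e e0; rewrite subrr.
by split; rewrite ?subr0 ?addr0; apply/pcone_scalar; exact: ltW.
Qed.

Lemma st1 : st 1 = 1.
Proof. by rewrite -[X in st X]scale1r st_scalar. Qed.

Lemma stM x y : finite x -> finite y -> st (x * y) = st x * st y.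
Proof.
move=> fx fy; have [ix iy] := (st_infinitesimal fx, st_infinitesimal fy).
apply: st_unique.
have [h1 _] := infinitesimalM ix fy.
have [_ h2] := infinitesimalM iy (finite_scalar (st x)).
have := infinitesimalD h1 h2.
by rewrite mulrBl mulrBr addrA subrK -vl_scalerAl mul1r scalerA.
Qed.

Lemma stZ a x : finite x -> st (a *: x) = a * st x.
Proof.
move=> fx; rewrite -{1}[x]mul1r vl_scalerAl stM ?st_scalar //.
exact: finite_scalar.
Qed.

Lemma stX x k : finite x -> st (x ^+ k) = st x ^+ k.
Proof.
move=> fx; elim: k => [|k IHk]; first exact: st1.
by rewrite !exprS stM ?IHk //; exact: finiteX.
Qed.

Lemma pcone_st x : finite x -> Q x -> 0 <= st x.
Proof.
move=> fx Qx; rewrite leNgt; apply/negP => s0.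
have [] := st_infinitesimal fx (e := - st x / 2); first lra.
move=> h _; have := pconeD Qp h Qx.
rewrite opprB addrA subrK -scalerDl => /pcone_scalar; lra.
Qed.

Lemma st_le x y : finite x -> finite y -> Q (y - x) -> st x <= st y.
Proof.
move=> fx fy Qxy; rewrite -subr_ge0 -stN // -stD //; last exact: finiteN.
by apply: pcone_st => //; apply: finiteD => //; exact: finiteN.
Qed.

Lemma st_homo x y : finite x -> finite y -> x <= y -> st x <= st y.
Proof.
by move=> fx fy xy; apply: st_le => //; apply: (pcone_ge0 Qp); rewrite latalg_subr_ge0.
Qed.

Lemma stU x y : finite x -> finite y -> st (x `|` y)%O = Num.max (st x) (st y).
Proof.
move=> fx fy; have [ix iy] := (st_infinitesimal fx, st_infinitesimal fy).
apply: st_unique => e e0; set m := Num.max _ _.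
have [sx sy] : st x <= m /\ st y <= m by rewrite /m !le_max !lexx orbT.
have up u : infinitesimal (u - st u *: idX) -> st u <= m -> Q (e *: idX - (u - m *: idX)).
  move=> iu su; have [+ _] := iu e e0.
  apply: pcone_le; rewrite !opprB latalg_leD // latalg_leD //.
  rewrite -latalg_subr_ge0 -scalerBl; apply: latalg_scale_ge0; first by rewrite subr_ge0.
  exact: falg_one_ge0.
split.
  rewrite opprB addrA addrC vl_oppU vl_meetDr; apply: (pconeI Qp).
    by rewrite [- x + _]addrC -addrA -[m *: idX - x]opprB; apply: up.
  by rewrite [- y + _]addrC -addrA -[m *: idX - y]opprB; apply: up.
have low u : infinitesimal (u - st u *: idX) -> u <= (x `|` y)%O -> st u = m ->
    Q (e *: idX + ((x `|` y)%O - m *: idX)).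
  move=> iu uxy <-; have [_] := iu e e0.
  by apply: pcone_le; rewrite latalg_leD // latalg_leD.
have [h|h] := leP (st x) (st y).
  by apply: (low y) => //; [exact: leUr|rewrite /m max_r].
by apply: (low x) => //; [exact: leUl|rewrite /m max_l // ltW].
Qed.

Lemma finiteU x y : finite x -> finite y -> finite (x `|` y)%O.
Proof.
move=> fx fy; apply: (finite_le (vabsU x y)).
by apply: finiteD; exact: finite_vabs.
Qed.

Lemma stI x y : finite x -> finite y -> st (x `&` y)%O = Num.min (st x) (st y).
Proof.
move=> fx fy; have fU := finiteU fx fy.
rewrite vl_meetU stD ?stN ?stU ?stD //; [|exact: finiteD|exact: finiteN].
by rewrite -(addr_max_min (st x)) addrC addKr.
Qed.

End Cone.
End StandardPart.

(** * Separation by standard parts *)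

Section Separation.
Variables (R : realType) (X : latticeAlg R).
Hypothesis X_f : is_f_algebra X.
Implicit Types (x y f : X) (C e : R) (k : nat).

Section Bounded.
Variables (f : X) (f1 : (1 : X) <= f).

Lemma power_ge1 k : (1 : X) <= f ^+ k.
Proof.
elim: k => [|k IHk]; first exact: lexx.
apply: (le_trans IHk); rewrite exprS -latalg_subr_ge0 -{2}[f ^+ k]mul1r -mulrBl.
apply: latalg_mul_ge0; first by rewrite -latalg_ge0 latalg_subr_ge0.
exact: le_trans (falg_one_ge0 X_f) IHk.
Qed.

Lemma power_ge0 k : 0 <= f ^+ k.
Proof. exact: le_trans (falg_one_ge0 X_f) (power_ge1 k). Qed.

Lemma power_homo k l : (k <= l)%N -> f ^+ k <= f ^+ l.
Proof.
move=> /subnK <-; rewrite exprD -latalg_subr_ge0 -{2}[f ^+ k]mul1r -mulrBl.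
apply: latalg_mul_ge0; last exact: power_ge0.
by rewrite -latalg_ge0 latalg_subr_ge0 power_ge1.
Qed.

Definition poly_bounded y : Prop :=
  exists k C, 0 <= C /\ vabs y <= C *: f ^+ k.

Lemma poly_boundedP y : poly_bounded y ->
  exists k C, 0 <= C /\ forall l, (k <= l)%N -> vabs y <= C *: f ^+ l.
Proof.
move=> [k [C [C0 yC]]]; exists k, C; split => // l kl.
by apply: (le_trans yC); apply: latalg_leZ => //; exact: power_homo.
Qed.

Lemma poly_bounded_le x y : vabs x <= vabs y -> poly_bounded y -> poly_bounded x.
Proof. by move=> xy [k [C [C0 yC]]]; exists k, C; split => //; exact: le_trans yC. Qed.

Lemma poly_bounded_add x y z : vabs z <= vabs x + vabs y ->
  poly_bounded x -> poly_bounded y -> poly_bounded z.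
Proof.
move=> zxy /poly_boundedP[k [C [C0 xC]]] /poly_boundedP[l [D [D0 yD]]].
exists (k + l)%N, (C + D); split; first exact: addr_ge0.
apply: (le_trans zxy); rewrite scalerDl latalg_leD //.
  by apply: xC; exact: leq_addr.
by apply: yD; exact: leq_addl.
Qed.

Lemma poly_boundedD x y : poly_bounded x -> poly_bounded y -> poly_bounded (x + y).
Proof. exact: poly_bounded_add (vabsD x y). Qed.

Lemma poly_boundedN x : poly_bounded x -> poly_bounded (- x).
Proof. by apply: poly_bounded_le; rewrite vabsN. Qed.

Lemma poly_boundedU x y : poly_bounded x -> poly_bounded y -> poly_bounded (x `|` y)%O.
Proof. exact: poly_bounded_add (vabsU x y). Qed.

Lemma poly_boundedI x y : poly_bounded x -> poly_bounded y -> poly_bounded (x `&` y)%O.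
Proof.
move=> bx b_y; rewrite vl_meetU.
by apply: poly_boundedD; [exact: poly_boundedD|apply: poly_boundedN; exact: poly_boundedU].
Qed.

Lemma poly_boundedZ a x : poly_bounded x -> poly_bounded (a *: x).
Proof.
move=> [k [C [C0 xC]]]; exists k, (`|a| * C); split; first exact: mulr_ge0.
have [a0|a0] := leP 0 a.
  rewrite ger0_norm // -scalerA vabs_le -scalerN; apply/andP.
  by split; apply: latalg_leZ => //; apply: le_trans xC; rewrite ?vabs_ge ?vabs_geN.
rewrite ltr0_norm // -scalerA -vabsN -scaleNr vabs_le -scalerN; apply/andP.
have na : 0 <= - a by rewrite oppr_ge0 ltW.
by split; apply: latalg_leZ => //; apply: le_trans xC; rewrite ?vabs_ge ?vabs_geN.
Qed.

Lemma vabsM x y : vabs (x * y) <= vabs x * vabs y.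
Proof.
have half (z : X) : 0 <= z + z -> 0 <= z.
  have h : 0 <= 2^-1 :> R by rewrite invr_ge0.
  move=> /(latalg_leZ h); rewrite scaler0 -mulr2n -[z *+ 2]scaler_nat scalerA.
  by rewrite mulVf ?pnatr_eq0 // scale1r.
have pos (z t : X) : 0 <= (vabs z - z) * (vabs t + t) + (vabs z + z) * (vabs t - t).
  have D u : 0 <= vabs u - u /\ 0 <= vabs u + u :> X.
    by rewrite latalg_subr_ge0 vabs_ge -{2}[u]opprK latalg_subr_ge0 vabs_geN.
  by have [z1 z2] := D z; have [t1 t2] := D t; apply: vl_addr_ge0; exact: latalg_mul_ge0.
rewrite vabs_le -[X in X && _]latalg_subr_ge0 -[X in _ && X]latalg_subr_ge0.
apply/andP; split; apply: half; first by rewrite -mul_cross.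
by rewrite -mulrN -mul_cross -(vabsN y); exact: pos.
Qed.

Lemma vl_mul_homo (x y u v : X) : 0 <= x -> 0 <= v -> x <= u -> y <= v -> x * y <= u * v.
Proof.
move=> x0 v0 xu yv; apply: (@le_trans _ _ (x * v)).
  rewrite -latalg_subr_ge0 -mulrBr; apply: latalg_mul_ge0 => //.
  by rewrite -latalg_ge0 latalg_subr_ge0.
rewrite -latalg_subr_ge0 -mulrBl; apply: latalg_mul_ge0 => //.
by rewrite -latalg_ge0 latalg_subr_ge0.
Qed.

Lemma poly_boundedM x y : poly_bounded x -> poly_bounded y -> poly_bounded (x * y).
Proof.
move=> [k [C [C0 xC]]] [l [D [D0 yD]]]; exists (k + l)%N, (C * D).
split; first exact: mulr_ge0.
apply: (le_trans (vabsM x y)).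
have -> : (C * D) *: f ^+ (k + l) = (C *: f ^+ k) * (D *: f ^+ l).
  by rewrite exprD -vl_scalerAl -vl_scalerAr scalerA.
apply: vl_mul_homo => //; first exact: vabs_ge0.
by apply: latalg_scale_ge0 => //; exact: power_ge0.
Qed.

Lemma poly_bounded_finite Q y : prime_cone Q -> finite Q f -> poly_bounded y -> finite Q y.
Proof.
move=> Qp ff [k [C [_ yC]]].
by apply: (finite_le X_f Qp yC); apply: finiteZ => //; exact: finiteX.
Qed.

Lemma poly_bounded1 : poly_bounded 1.
Proof.
exists 0%N, 1; split => //; rewrite expr0 scale1r vabs_id //.
exact: falg_one_ge0.
Qed.

Hypothesis X_arch : archimedean_vlattice X.

(** If [y <= e f^(k+1)] fails, some prime cone makes [e f^(k+1) <= y <= C f^k];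
    as [f >= 1] this bounds [f] by a real in the corresponding quotient, so that
    the standard part is defined there and is positive at [y]. *)
Lemma st_le0 y : poly_bounded y ->
  (forall Q, prime_cone Q -> finite Q f -> st Q y <= 0) -> y <= 0.
Proof.
move=> b_y Hy; have [k [C [C0 yC]]] := b_y.
have yCk : y <= C *: f ^+ k by exact: le_trans (vabs_ge y) yC.
apply: (archimedean_le0 X_arch (power_ge0 k.+1)) => e.
move=> e0; rewrite -[_ <= _]negbK; apply/negP => yN.
have [|Q [Qp Qy]] := prime_cone_separation X_f (x := y - e *: f ^+ k.+1).
  by rewrite vl_leBl add0r.
have QC : Q (C *: f ^+ k - y) by apply: (pcone_ge0 Qp); rewrite latalg_subr_ge0.
have ff : finite Q f.
  (* If [f >= K] at [Q] then [C f^k >= y >= e f^(k+1) >= (C + 1) f^k] there. *)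
  pose K := (C + 1) / e; have K0 : 0 <= K by rewrite divr_ge0 // ?ltW // ltr_wpDl.
  apply: (@finite_dominated _ _ X_f _ Qp K); split; last first.
    apply: (pcone_ge0 Qp); apply: vl_addr_ge0.
      by apply: latalg_scale_ge0 => //; exact: falg_one_ge0.
    exact: le_trans (falg_one_ge0 X_f) f1.
  have [//|] := pcone_total Qp (K *: (1 : X) - f).
  rewrite opprB => QK; exfalso; apply: (pconeN1 Qp).
  have Qfk := pcone_ge0 Qp (power_ge0 k).
  have := pconeZ X_f Qp (ltW e0) (pconeM Qp QK Qfk).
  rewrite mulrBl -exprS -vl_scalerAl mul1r scalerBr scalerA.
  rewrite /K mulrC divfK ?gt_eqF // scalerDl scale1r => h.
  have := pconeD Qp (pconeD Qp (pconeD Qp QC Qy) h)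
    (pcone_ge0 Qp (x := f ^+ k - 1) _).
  rewrite latalg_subr_ge0 power_ge1 => /(_ isT).
  by rewrite !subrKA opprD [X in Q (X + _)]addrA subrr add0r addKr.
have fy := poly_bounded_finite Qp ff b_y.
have fek : finite Q (e *: f ^+ k.+1) by apply: finiteZ => //; exact: finiteX.
have := st_le X_f Qp fek fy Qy; rewrite stZ ?stX //; last exact: finiteX.
move=> /le_trans/(_ (Hy Q Qp ff)); apply/negP; rewrite -ltNge mulr_gt0 //.
apply: (@lt_le_trans _ _ 1) => //; rewrite exprn_ege1 // -(st1 X_f Qp).
by apply: st_homo => //; exact: finite1.
Qed.

Lemma st_separation x y : poly_bounded x -> poly_bounded y ->
  (forall Q, prime_cone Q -> finite Q f -> st Q x <= st Q y) -> x <= y.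
Proof.
move=> bx b_y H; rewrite -[y]add0r -vl_leBl.
have bNy := poly_boundedN b_y.
apply: st_le0 => [|Q Qp ff]; first exact: poly_boundedD.
have [fx fy] := (poly_bounded_finite Qp ff bx, poly_bounded_finite Qp ff b_y).
by rewrite stD // ?stN // ?subr_le0 ?H //; exact: finiteN.
Qed.

Lemma st_inj x y : poly_bounded x -> poly_bounded y ->
  (forall Q, prime_cone Q -> finite Q f -> st Q x = st Q y) -> x = y.
Proof.
move=> bx b_y H; apply/eqP; rewrite eq_le.
by apply/andP; split; apply: st_separation => // Q Qp ff; rewrite H.
Qed.

End Bounded.
End Separation.

(** * Functions of polynomial growth *)

Section PolynomialGrowth.
Variables (R : realType) (n : nat).
Implicit Types (f g h p : PG R n) (s t a : 'rV[R]_n) (C M e : R).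
Local Notation onePG := (1 : PG R n).

Definition pgabs f : PG R n := (f `|` - f)%O.

Lemma pgabsE f t : pgabs f t = `|f t|.
Proof.
by rewrite PG_joinE PG_oppE; case: (leP 0 (f t)) => h;
  [rewrite ger0_norm // max_l|rewrite ltr0_norm // max_r]; lra.
Qed.

Lemma PG_sumE (I : Type) (r : seq I) (F : I -> PG R n) t :
  (\sum_(i <- r) F i) t = \sum_(i <- r) F i t.
Proof. by elim: r => [|i r IHr]; rewrite ?big_nil // !big_cons PG_addE IHr. Qed.

Lemma PG_expE f k t : (f ^+ k) t = f t ^+ k.
Proof. by elim: k => [|k IHk]; rewrite ?exprS ?PG_mulE ?IHk. Qed.

Definition weight : PG R n := 1 + \sum_(i < n) pgabs (PG_proj R i).

Lemma weightE t : weight t = 1 + \sum_(i < n) `|t ord0 i|.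
Proof.
rewrite PG_addE PG_sumE PG_oneE; congr (_ + _).
by apply: eq_bigr => i _; rewrite pgabsE.
Qed.

Lemma weight_ge1 t : 1 <= weight t.
Proof. by rewrite weightE; exact: PG_weight_ge1. Qed.

Definition l1dist a : PG R n := \sum_(i < n) pgabs (PG_proj R i - a ord0 i *: onePG).

Lemma l1distE a t : l1dist a t = \sum_(i < n) `|t ord0 i - a ord0 i|.
Proof.
rewrite PG_sumE; apply: eq_bigr => i _.
by rewrite pgabsE PG_addE PG_oppE PG_scaleE PG_oneE mulr1.
Qed.

Lemma l1dist_ge0 a t : 0 <= l1dist a t.
Proof. by rewrite l1distE sumr_ge0. Qed.

Lemma l1distxx a : l1dist a a = 0.
Proof. by rewrite l1distE big1 // => i _; rewrite subrr normr0. Qed.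

Lemma PG_continuous f : continuous f.
Proof. exact: PG_cont (PG_funP f). Qed.

Lemma PG_growth h : exists N M, 0 <= M /\ forall k, (N <= k)%N ->
  forall t, `|h t| <= M * weight t ^+ k.
Proof.
have [N [M [M0 hM]]] := PG_bound (PG_funP h); exists N, M; split=> // k Nk t.
by rewrite weightE; exact: hM.
Qed.

Lemma PG_modulus h a e : 0 < e ->
  exists2 d, 0 < d & forall t, l1dist a t < d -> `|h t - h a| < e.
Proof.
move=> e0; have /cvgrPdist_lt/(_ e e0) := @PG_continuous h a.
move=> /nbhs_ballP[d d0 hd]; exists d => // t td; rewrite distrC; apply: hd.
split=> // i j; rewrite ord1 /ball /= distrC; apply: le_lt_trans td.
by rewrite l1distE (bigD1 j) //= lerDl sumr_ge0.
Qed.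

(** Away from [a] the distance is bounded below, hence absorbs the growth. *)
Lemma PG_dist_bound h a e : 0 < e -> exists C k, 0 <= C /\
  forall t, `|h t - h a| <= e + C * (l1dist a t * weight t ^+ k).
Proof.
move=> e0; have [d d0 hd] := PG_modulus h a e0.
have [N [M [M0 hM]]] := PG_growth (h - h a *: onePG).
exists (M / d), N; split; first by rewrite divr_ge0 // ltW.
move=> t; have wN0 : 0 <= weight t ^+ N by rewrite exprn_ge0 // (le_trans ler01) ?weight_ge1.
have [td|td] := ltP (l1dist a t) d.
  apply: (le_trans (ltW (hd t td))); rewrite lerDl mulr_ge0 //.
    by rewrite divr_ge0 // ltW.
  by rewrite mulr_ge0 // l1dist_ge0.
have := hM N (leqnn N) t; rewrite PG_addE PG_oppE PG_scaleE PG_oneE mulr1.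
move=> /le_trans; apply; apply: (@le_trans _ _ (M / d * (l1dist a t * weight t ^+ N))).
  rewrite mulrA ler_wpM2r // mulrAC ler_pdivlMr // ler_wpM2l //.
by rewrite lerDr ltW.
Qed.

(** Although [L] may contain nothing growing more than linearly,
    [h - e w^(N+1)] is bounded above, so that for every [s] it is dominated by a
    cone [h s + C |t - s|]; finitely many such cones and a constant have a
    minimum below [h + e w^(N+1)], since outside some compact box the constant
    is. *)
Lemma weighted_lattice_approximation (L : set (PG R n)) h N M e :
    L 1 -> (forall i, L (PG_proj R i)) ->
    (forall c f g, L f -> L g -> L (c *: f + g)) ->
    (forall f g, L f -> L g -> L (f `&` g)%O /\ L (f `|` g)%O) ->
    0 <= M -> (forall t, `|h t| <= M * weight t ^+ N) -> 0 < e ->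
  exists2 p, L p & forall t, `|h t - p t| <= e * weight t ^+ N.+1.
Proof.
move=> L1 Lproj Llin Llat M0 hM e0.
have L0 : L 0 by have := Llin (-1) _ _ L1 L1; rewrite scaleN1r addNr.
have LZ c f : L f -> L (c *: f) by move=> Lf; have := Llin c _ _ Lf L0; rewrite addr0.
have LD f g : L f -> L g -> L (f + g).
  by move=> Lf Lg; have := Llin 1 _ _ Lf Lg; rewrite scale1r.
have Ldist a : L (l1dist a).
  apply: (big_ind L) => // i _; have Lu : L (PG_proj R i - a ord0 i *: onePG).
    by apply: LD => //; rewrite -scaleNr; exact: LZ.
  by apply: (proj2 (Llat _ _ _ _)) => //; rewrite -scaleN1r; exact: LZ.
pose E t := e * weight t ^+ N.+1.
have w0 t : 0 <= weight t by rewrite (le_trans ler01) ?weight_ge1.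
have wN1 t : 1 <= weight t ^+ N by rewrite exprn_ege1 // weight_ge1.
have Ee t : e <= E t.
  by rewrite /E -{1}[e]mulr1 ler_wpM2l ?exprn_ege1 ?weight_ge1 // ltW.
(* [M w^N - e w^(N+1)] is at most 0 once [w >= M / e], and before that
   [M w^N <= C0]. *)
pose C0 := M * (M / e) ^+ N.
have Me0 : 0 <= M / e by rewrite divr_ge0 // ltW.
have C00 : 0 <= C0 by rewrite mulr_ge0 ?exprn_ge0.
have top t : h t - E t <= C0.
  have := ler_norm (h t) => /le_trans/(_ (hM t)) ht.
  have [wM|wM] := leP (M / e) (weight t).
    apply: le_trans C00; rewrite subr_le0; apply: (le_trans ht).
    rewrite /E exprS mulrA ler_wpM2r //; first exact: le_trans (wN1 t).
    by move: wM; rewrite ler_pdivrMr // mulrC.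
  apply: (@le_trans _ _ (h t)); first by rewrite gerBl (le_trans (ltW e0)).
  apply: (le_trans ht); rewrite ler_wpM2l // lerXn2r ?nnegrE //; exact: ltW.
(* [B] solves [e B - M = C0]. *)
pose B := (C0 + M) / e.
have far t : B <= weight t -> C0 <= h t + E t.
  rewrite ler_pdivrMr // => Bt; have := ler_norm (- h t).
  rewrite normrN => /le_trans/(_ (hM t)) ht.
  have : 0 <= (weight t ^+ N - 1) * (weight t * e - M).
    by rewrite mulr_ge0 ?subr_ge0 //; lra.
  by rewrite /E exprS; move: ht Bt C00 (wN1 t); set x := weight t ^+ N; nra.
have cone s : exists C, 0 <= C /\ forall t, h t - E t <= h s + C * l1dist s t.
  have [d d0 hd] := PG_modulus h s e0.
  exists ((C0 + `|h s|) / d); split; first by rewrite divr_ge0 ?addr_ge0 // ltW.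
  move=> t; have [td|td] := ltP (l1dist s t) d.
    have := hd t td; rewrite ltr_norml => /andP[_ hts].
    have : 0 <= (C0 + `|h s|) / d * l1dist s t.
      by rewrite mulr_ge0 ?l1dist_ge0 // divr_ge0 ?addr_ge0 // ltW.
    have := Ee t; lra.
  have : (C0 + `|h s|) <= (C0 + `|h s|) / d * l1dist s t.
    by rewrite mulrAC ler_pdivlMr // ler_wpM2l // addr_ge0.
  have := top t; have := ler_norm (- h s); rewrite normrN; lra.
have /choice[c cP] := cone.
pose P s : PG R n := h s *: onePG + c s *: l1dist s.
have PE s t : P s t = h s + c s * l1dist s t.
  by rewrite PG_addE !PG_scaleE PG_oneE mulr1.
have LP s : L (P s) by apply: LD; apply: LZ.
have minP (r : seq 'rV[R]_n) : exists2 p, L p &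
    forall t, h t - E t <= p t /\ p t <= C0 /\ forall s, s \in r -> p t <= P s t.
  elim: r => [|s r [p Lp hp]].
    exists (C0 *: onePG); first exact: LZ.
    by move=> t; rewrite PG_scaleE PG_oneE mulr1.
  exists (P s `&` p)%O; first exact: (proj1 (Llat _ _ (LP s) Lp)).
  move=> t; have [p1 [p2 p3]] := hp t; rewrite PG_meetE le_min p1 PE.
  have [_ ->] := cP s; split=> //; split; first by rewrite ge_min p2 orbT.
  move=> u; rewrite in_cons => /orP[/eqP ->|ur]; first by rewrite PE ge_min lexx.
  by rewrite ge_min (p3 _ ur) orbT.
pose K : set 'rV[R]_n := [set t | forall i, `[- B, B]%classic (t ord0 i)].
have cK : compact K by apply: (@rV_compact _ _ (fun=> `[- B, B]%classic)) => i; exact: segment_compact.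
pose U s : set 'rV[R]_n := [set t | P s t < h t + E t].
have oU s : open (U s).
  pose F : PG R n := h + e *: weight ^+ N.+1 - P s.
  have -> : U s = F @^-1` [set x | 0 < x].
    have FE t : F t = h t + E t - P s t.
      by rewrite /F !PG_addE PG_oppE PG_scaleE PG_expE.
    by apply/seteqP; split=> t; rewrite /preimage /mkset FE subr_gt0.
  apply: open_comp; last exact: open_gt.
  by move=> t _; apply: (@PG_continuous F).
move: cK; rewrite compact_cover => /(_ _ K U (fun s _ => oU s)).
case.
  move=> t Kt; exists t => //; rewrite /U /mkset PE l1distxx mulr0 addr0.
  by rewrite ltrDl (lt_le_trans e0).
move=> D _ KD; have [p Lp hp] := minP (finmap.enum_fset D).
exists p => // t; have [p1 [p2 p3]] := hp t.
rewrite ler_norml -/(E t); suff : p t <= h t + E t by lra.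
have [Kt|nK] := pselect (K t).
  by have [s /= sD Us] := KD t Kt; apply: (le_trans (p3 s sD)); exact: ltW.
apply: (le_trans p2); apply: far; rewrite leNgt; apply/negP => wB; apply: nK => i /=.
rewrite in_itv /= -ler_norml; apply: (le_trans _ (ltW wB)).
rewrite weightE (bigD1 i) //= addrCA lerDl.
by rewrite addr_ge0 // sumr_ge0.
Qed.

End PolynomialGrowth.

(** * Uniqueness of the calculus *)

Section Calculus.
Variables (R : realType) (X : latticeAlg R) (n : nat) (x : 'I_n -> X).
Variables (Psi : PG R n -> X) (Psi_calc : is_PG_calculus_at x Psi).
Implicit Types (f g h : PG R n) (c : R).
Local Notation onePG := (1 : PG R n).

Lemma calcM f g : Psi (f * g) = Psi f * Psi g.
Proof. by have [[_ + _ _] _ _] := Psi_calc; exact. Qed.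

Lemma calcI f g : Psi (f `&` g)%O = (Psi f `&` Psi g)%O.
Proof. by have [[_ _ + _] _ _] := Psi_calc; exact. Qed.

Lemma calcU f g : Psi (f `|` g)%O = (Psi f `|` Psi g)%O.
Proof. by have [[_ _ _ +] _ _] := Psi_calc; exact. Qed.

Lemma calc1 : Psi 1 = 1.
Proof. by have [] := Psi_calc. Qed.

Lemma calc_proj i : Psi (PG_proj R i) = x i.
Proof. by have [] := Psi_calc. Qed.

Lemma calc_lin c f g : Psi (c *: f + g) = c *: Psi f + Psi g.
Proof. by have [[+ _ _ _] _ _] := Psi_calc; exact. Qed.

Lemma calcD f g : Psi (f + g) = Psi f + Psi g.
Proof. by have := calc_lin 1 f g; rewrite !scale1r. Qed.

Lemma calc0 : Psi 0 = 0.
Proof. by apply: (addrI (Psi 0)); rewrite -calcD !addr0. Qed.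

Lemma calcZ c f : Psi (c *: f) = c *: Psi f.
Proof. by have := calc_lin c f 0; rewrite calc0 !addr0. Qed.

Lemma calcN f : Psi (- f) = - Psi f.
Proof. by rewrite -scaleN1r calcZ scaleN1r. Qed.

Lemma calcB f g : Psi (f - g) = Psi f - Psi g.
Proof. by rewrite calcD calcN. Qed.

Lemma calcX f k : Psi (f ^+ k) = Psi f ^+ k.
Proof. by elim: k => [|k IHk]; rewrite ?calc1 // !exprS calcM IHk. Qed.

Lemma calc_abs f : Psi (pgabs f) = vabs (Psi f).
Proof. by rewrite calcU calcN. Qed.

Lemma calc_homo f g : (forall t, f t <= g t) -> Psi f <= Psi g.
Proof.
move=> fg; have -> : g = (f `|` g)%O.
  by apply: PG_ext => t; rewrite PG_joinE max_r.
by rewrite calcU leUl.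
Qed.

Lemma calc_sum (I : Type) (r : seq I) (F : I -> PG R n) :
  Psi (\sum_(i <- r) F i) = \sum_(i <- r) Psi (F i).
Proof.
by elim: r => [|i r IHr]; rewrite ?big_nil ?calc0 // !big_cons calcD IHr.
Qed.

Lemma calc_weight : Psi (weight R n) = 1 + \sum_(i < n) vabs (x i).
Proof.
rewrite calcD calc1 calc_sum; congr (_ + _).
by apply: eq_bigr => i _; rewrite calc_abs calc_proj.
Qed.

Lemma calc_weight_ge1 : (1 : X) <= Psi (weight R n).
Proof. by rewrite -calc1; apply: calc_homo => t; rewrite PG_oneE weight_ge1. Qed.

Lemma calc_bounded h : poly_bounded (Psi (weight R n)) (Psi h).
Proof.
have [N [M [M0 hM]]] := PG_growth h; exists N, M; split=> //.
rewrite -calc_abs -calcX -calcZ; apply: calc_homo => t.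
by rewrite pgabsE PG_scaleE PG_expE hM.
Qed.

Hypothesis X_f : is_f_algebra X.

(** [st Q \o Psi] is a real-valued homomorphism on [PG_n], hence the evaluation
    at the point [a] of its values on the coordinates: [|h - h a|] lies below
    [e + C d w^k] and the distance [d] to [a] is sent to 0. *)
Lemma calc_eval Q h : prime_cone Q -> finite Q (Psi (weight R n)) ->
  st Q (Psi h) = h (\row_i st Q (x i)).
Proof.
move=> Qp fw; set a := \row_i _.
have fin g : finite Q (Psi g).
  exact: (poly_bounded_finite X_f Qp fw (calc_bounded g)).
have stc c : st Q (Psi (c *: onePG)) = c by rewrite calcZ calc1 st_scalar.
have stabs g : st Q (Psi (pgabs g)) = `|st Q (Psi g)|.
  rewrite calc_abs /vabs stU ?stN //; last exact: finiteN.
  by case: (leP 0 (st Q (Psi g))) => s0;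
    [rewrite ger0_norm // max_l|rewrite ltr0_norm // max_r]; lra.
have stB g k : st Q (Psi (g - k)) = st Q (Psi g) - st Q (Psi k).
  by rewrite calcB stD ?stN //; exact: finiteN.
have d0 : st Q (Psi (l1dist a)) = 0.
  apply: (big_ind (fun g => st Q (Psi g) = 0)) => [|f g f0 g0|i _].
  - by rewrite -(scale0r onePG) stc.
  - by rewrite calcD stD // f0 g0 addr0.
  - by rewrite stabs stB stc calc_proj mxE subrr normr0.
apply/eqP; rewrite -subr_eq0 -normr_le0; apply/ler_addgt0Pl => e e0.
have [C [k [C0 hC]]] := PG_dist_bound h a e0; rewrite addr0.
rewrite -[h a]stc -stB -stabs.
apply: (@le_trans _ _ (st Q (Psi (e *: onePG + C *: (l1dist a * weight R n ^+ k))))).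
  apply: st_homo => //; apply: calc_homo => t.
  rewrite pgabsE !PG_addE PG_oppE !PG_scaleE PG_oneE !mulr1 PG_mulE PG_expE.
  exact: hC.
by rewrite calcD stD // stc calcZ stZ // calcM stM // d0 mul0r mulr0 addr0.
Qed.

End Calculus.

(** [Psi h] and [Psi' h] have the same standard parts, by evaluation. *)
Lemma PG_calculus_unique (R : realType) (X : latticeAlg R) (n : nat)
    (x : 'I_n -> X) (Psi Psi' : PG R n -> X) :
  archimedean_vlattice X -> is_f_algebra X ->
  is_PG_calculus_at x Psi -> is_PG_calculus_at x Psi' -> Psi = Psi'.
Proof.
move=> X_arch X_f calc calc'; apply/funext => h.
have E : Psi (weight R n) = Psi' (weight R n).
  by rewrite (calc_weight calc) (calc_weight calc').
apply: (st_inj X_f (calc_weight_ge1 calc) X_arch (calc_bounded calc h)).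
  by rewrite E; exact: calc_bounded calc' h.
move=> Q Qp fw; rewrite (calc_eval calc) // (calc_eval calc') //.
by rewrite -E.
Qed.

(** With uniqueness, this yields the composition formula. *)
Lemma PG_calculus_comp (R : realType) (X : latticeAlg R) (m n : nat)
    (x : 'I_n -> X) (Psi_x : PG R n -> X) (fs : 'I_m -> PG R n) :
  is_PG_calculus_at x Psi_x ->
  is_PG_calculus_at (fun i => Psi_x (fs i)) (fun g : PG R m => Psi_x (PG_comp g fs)).
Proof.
move=> calc; split; first split.
- move=> c f g; rewrite -(calc_lin calc); congr Psi_x.
  by apply: PG_ext.
- move=> f g; rewrite -(calcM calc); congr Psi_x; exact: PG_ext.
- move=> f g; rewrite -(calcI calc); congr Psi_x; apply: PG_ext => t.
  by rewrite PG_meetE; exact: PG_meetE.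
- move=> f g; rewrite -(calcU calc); congr Psi_x; apply: PG_ext => t.
  by rewrite PG_joinE; exact: PG_joinE.
- by rewrite -(calc1 calc); congr Psi_x; exact: PG_ext.
- by move=> i; congr Psi_x; apply: PG_ext => t; rewrite /= mxE.
Qed.

(** A disjoint pair is the image of a disjoint pair of functions, and disjoint
    functions remain disjoint when one is multiplied by a positive function. *)
Lemma PG_calculus_f_algebra (R : realType) (X : latticeAlg R) :
  admits_PG_calculus X -> is_f_algebra X.
Proof.
move=> adm x y z xy0 z0.
pose v (i : 'I_3) : X := if i == 0%N :> nat then x else if i == 1%N :> nat then y else z.
have [Psi calc] := adm 3%N isT v.
pose p (i : 'I_3) : PG R 3 := PG_proj R i.
pose i0 : 'I_3 := @Ordinal 3 0 isT; pose i1 : 'I_3 := @Ordinal 3 1 isT.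
pose i2 : 'I_3 := @Ordinal 3 2 isT.
pose f := p i0 - (p i0 `&` p i1)%O; pose g := p i1 - (p i0 `&` p i1)%O.
pose k := (p i2 `|` 0)%O : PG R 3.
have xE : Psi f = x.
  by rewrite (calcB calc) (calcI calc) !(calc_proj calc) /v /= xy0 subr0.
have yE : Psi g = y.
  by rewrite (calcB calc) (calcI calc) !(calc_proj calc) /v /= xy0 subr0.
have zE : Psi k = z.
  by rewrite (calcU calc) (calc_proj calc) (calc0 calc) /v /=; apply/join_idPl.
rewrite -xE -yE -zE -!(calcM calc) -!(calcI calc) -(calc0 calc).
have disj t : Num.min (k t * f t) (g t) = 0.
  rewrite /k /f /g PG_joinE !PG_addE !PG_oppE PG_meetE PG_zeroE.
  have h0 : 0 <= Num.max (p i2 t) 0 by rewrite le_max lexx orbT.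
  have [h|h] := leP (p i0 t) (p i1 t).
    by rewrite subrr mulr0 min_l // subr_ge0.
  by rewrite subrr min_r // mulr_ge0 // subr_ge0 ltW.
split; congr Psi; apply: PG_ext => t; rewrite PG_meetE PG_mulE ?disj //.
by rewrite mulrC disj.
Qed.

(** * Ideal norms and closed sublattices *)

Section IdealNorm.
Variables (R : realType) (X : latticeAlg R).
Variables (e : X) (e0 : 0 <= e).
Implicit Types (x y z : X) (l eps : R) (A B : set X).

Lemma order_idealP x : order_ideal e x <-> exists2 l, 0 <= l & vabs x <= l *: e.
Proof. by rewrite order_idealE. Qed.

Lemma ideal_norm_ge0 x : 0 <= ideal_norm e x.
Proof.
rewrite /ideal_norm; set S := [set l | _].
have [->|/set0P S0] := eqVneq S set0; first by rewrite inf0.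
by apply: lb_le_inf => // l [].
Qed.

Lemma ideal_norm_le l x : 0 <= l -> vabs x <= l *: e -> ideal_norm e x <= l.
Proof.
by move=> l0 xl; apply: ge_inf => //; exists 0 => k [].
Qed.

Lemma scale_homo l k : l <= k -> l *: e <= k *: e.
Proof.
move=> lk; rewrite -latalg_subr_ge0 -scalerBl.
by apply: latalg_scale_ge0 => //; rewrite subr_ge0.
Qed.

Lemma ideal_norm_lt eps x : order_ideal e x -> ideal_norm e x < eps ->
  vabs x <= eps *: e.
Proof.
move=> /order_idealP[l l0 xl] xeps.
have hS : has_inf [set l | 0 <= l /\ vabs x <= l *: e].
  by split; [exists l|exists 0 => k []].
have [k [k0 xk] keps] : exists2 k, (0 <= k /\ vabs x <= k *: e) & k < eps.
  have d0 : 0 < eps - ideal_norm e x by rewrite subr_gt0.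
  have [k Sk keps] := inf_adherent d0 hS.
  by exists k => //; move: keps; rewrite addrC subrK.
by apply: (le_trans xk); apply: scale_homo; exact: ltW.
Qed.

Lemma order_ideal_sublattice : is_vector_sublattice (order_ideal e).
Proof.
have add x y z : vabs z <= vabs x + vabs y ->
    order_ideal e x -> order_ideal e y -> order_ideal e z.
  move=> zxy /order_idealP[l l0 xl] /order_idealP[k k0 yk]; apply/order_idealP.
  exists (l + k); first exact: addr_ge0.
  by apply: (le_trans zxy); rewrite scalerDl latalg_leD.
have sub : is_subspace (order_ideal e).
  split; first by move=> A [[[A0 _] _] _].
  move=> a x y Ix Iy B CB; have [[[_ lin] _] _] := CB.
  by apply: lin; [exact: Ix|exact: Iy].
split=> // x y Ix Iy.
have IN z : order_ideal e z -> order_ideal e (- z).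
  by move=> /order_idealP h; apply/order_idealP; rewrite vabsN.
split; last exact: (add _ _ _ (vabsU x y)).
rewrite -[(x `&` y)%O]opprK vl_oppI; apply: (IN).
by apply: (add _ _ _ (vabsU (- x) (- y))); exact: IN.
Qed.

Lemma order_idealB x y : order_ideal e x -> order_ideal e y -> order_ideal e (x - y).
Proof.
have [[_ lin] _] := order_ideal_sublattice.
by move=> Ix Iy; have := lin (-1) _ _ Iy Ix; rewrite scaleN1r addrC.
Qed.

Lemma vabs_dist_le l k x y z : vabs (x - y) <= l *: e -> vabs (y - z) <= k *: e ->
  vabs (x - z) <= (l + k) *: e.
Proof.
move=> xy yz; rewrite scalerDl -[x - z](subrKA y); apply: (le_trans (vabsD _ _)).
exact: latalg_leD.
Qed.

Lemma vabs_distC x y : vabs (x - y) = vabs (y - x).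
Proof. by rewrite -vabsN opprB. Qed.

Lemma vabs_eq0 x : archimedean_vlattice X ->
  (forall l, 0 < l -> vabs x <= l *: e) -> x = 0.
Proof.
move=> X_arch /(archimedean_le0 X_arch e0); rewrite vabs_le => /andP[x1 x2].
by apply/eqP; rewrite eq_le x1 -[x]opprK vl_leNr oppr0.
Qed.

Section ClosedSublattice.
Variables (A : set X) (A_ideal : A `<=` order_ideal e).
Let L := closed_sublattice e A.

Lemma closed_sublattice_gen : A `<=` L.
Proof. by move=> x Ax B [_ AB]; exact: AB. Qed.

Lemma closed_sublattice_ideal : L `<=` order_ideal e.
Proof.
apply: smallest_sub => //; split=> //; exact: order_ideal_sublattice.
Qed.

Lemma closed_sublattice_sublattice : is_vector_sublattice L.
Proof.
split; first split.
- by move=> B [[[[B0 _] _] _ _] _].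
- by move=> a x y Lx Ly B CB; have [[[[_ lin] _] _ _] _] := CB; apply: lin; [exact: Lx|exact: Ly].
- move=> x y Lx Ly; split=> B CB; have [[[_ lat] _ _] _] := CB;
  by have [] := lat x y (Lx B CB) (Ly B CB).
Qed.

Lemma closed_sublattice_closed : norm_closed e L.
Proof.
move=> x Ix H B CB; have [[_ _ Bcl] _] := CB; apply: Bcl => // eps eps0.
by have [a La ax] := H eps eps0; exists a => //; exact: La.
Qed.

End ClosedSublattice.

End IdealNorm.

(** * Necessity *)

Lemma half_power_small (R : realType) (d : R) : 0 < d -> exists k, 2^-1 ^+ k < d.
Proof.
move=> d0; exists (Num.bound d^-1).
have h : d^-1 < (Num.bound d^-1)%:R by apply: archi_boundP; rewrite invr_ge0 ltW.
rewrite exprVn -[X in _ < X]invrK ltf_pV2 ?posrE ?invr_gt0 ?exprn_gt0 //.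
apply: (lt_trans h); rewrite -natrX ltr_nat. exact: ltn_expl.
Qed.

Section UniformLift.
Variables (R : realType) (X : latticeAlg R) (n : nat) (x : 'I_n -> X).
Variables (Psi : PG R n -> X) (Psi_calc : is_PG_calculus_at x Psi).
Variables (F : PG R n) (F0 : forall t, 0 <= F t).
Local Notation q k := (2^-1 ^+ k : R).

(** Truncating the increments between [- 2^-k F] and [2^-k F] does not change
    their images, and makes the partial sums converge already in [PG_n]. *)
Lemma uniform_lift (h : nat -> PG R n) :
  (forall k, vabs (Psi (h k.+1) - Psi (h k)) <= q k *: Psi F) ->
  exists H : PG R n, forall k, vabs (Psi H - Psi (h k)) <= (2 * q k) *: Psi F.
Proof.
move=> hP.
pose clip k : PG R n := (q k *: F `&` (- (q k *: F) `|` (h k.+1 - h k)))%O.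
pose S := fix S k := if k is k'.+1 then S k' + clip k' else h 0%N.
have SS k : S k.+1 = S k + clip k by [].
have q0 k : 0 < q k by rewrite exprn_gt0.
have SE k : Psi (S k) = Psi (h k).
  elim: k => // k IHk; rewrite SS (calcD Psi_calc) IHk (calcI Psi_calc) (calcU Psi_calc).
  rewrite (calcN Psi_calc) (calcZ Psi_calc) (calcB Psi_calc).
  have := hP k; rewrite vabs_le => /andP[h1 h2].
  have h3 : - (q k *: Psi F) <= Psi (h k.+1) - Psi (h k) by rewrite -vl_leN2 opprK.
  by rewrite (join_r h3) (meet_r h1) addrC subrK.
have Sinc k t : `|S k.+1 t - S k t| <= q k * F t.
  rewrite SS PG_addE addrC addKr PG_meetE PG_joinE !PG_oppE !PG_scaleE.
  have qF : 0 <= q k * F t by rewrite mulr_ge0 // ltW.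
  rewrite ler_norml le_min ge_min lexx /= andbT le_max lexx orTb andbT; lra.
have qS k : q k.+1 = q k / 2 by rewrite exprSr.
have nest k l t : S l t - 2 * q l * F t <= S k t + 2 * q k * F t.
  have up j : S (k + j)%N t + 2 * q (k + j)%N * F t <= S k t + 2 * q k * F t.
    elim: j => [|j]; first by rewrite addn0.
    apply: le_trans; rewrite addnS; have := Sinc (k + j)%N t.
    rewrite ler_norml qS; set z := q _ * F t; rewrite -[2 * (_ / 2) * _]mulrA.
    have -> : 2^-1 ^+ (k + j) / 2 * F t = z / 2 by rewrite mulrAC.
    rewrite -[2 * _ * _]mulrA -/z; lra.
  have low j : S l t - 2 * q l * F t <= S (l + j)%N t - 2 * q (l + j)%N * F t.
    elim: j => [|j IHj]; first by rewrite addn0.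
    apply: (le_trans IHj); rewrite addnS; have := Sinc (l + j)%N t.
    rewrite ler_norml qS; set z := q _ * F t; rewrite -[2 * (_ / 2) * _]mulrA.
    have -> : 2^-1 ^+ (l + j) / 2 * F t = z / 2 by rewrite mulrAC.
    rewrite -[2 * _ * _]mulrA -/z; lra.
  apply: (le_trans (low k)); apply: le_trans (up l); rewrite addnC.
  have := mulr_ge0 (ltW (q0 (k + l)%N)) (F0 t); set z := q _ * F t.
  rewrite -[2 * _ * _]mulrA -/z; lra.
(* The intervals [S k t +- 2 q k F t] are nested; [H t] is a common point. *)
pose H t : R := sup (range (fun l => S l t - 2 * q l * F t)).
have HS k t : `|H t - S k t| <= 2 * q k * F t.
  have ub : has_sup (range (fun l => S l t - 2 * q l * F t)).
    split; first by exists (S 0%N t - 2 * q 0%N * F t), 0%N.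
    by exists (S 0%N t + 2 * q 0%N * F t) => _ [l _ <-]; exact: nest.
  have h1 : S k t - 2 * q k * F t <= H t by apply: ub_le_sup; [case: ub|exists k].
  have h2 : H t <= S k t + 2 * q k * F t.
    by apply: ge_sup; [case: ub|move=> _ [l _ <-]; exact: nest].
  rewrite ler_norml; lra.
have cH : continuous H.
  move=> t; have Ft : Filter (nbhs (t : 'rV[R]_n)) by exact: nbhs_filter.
  apply/cvgrPdist_lt => e e0.
  have [k kd] := half_power_small (d := e / (4 * (2 * F t + 1))) ltac:(
    by rewrite divr_gt0 // mulr_gt0 // ltr_wpDl // mulr_ge0).
  have /cvgrPdist_lt/(_ (e / 2)) := @PG_continuous _ _ (S k) t.
  move=> /(_ (divr_gt0 e0 (ltr0n _ 2))) nS.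
  have /cvgrPdist_lt/(_ 1 ltr01) nF := @PG_continuous _ _ F t.
  near=> s.
  have s1 : `|S k t - S k s| < e / 2 by near: s.
  have s2 : `|F t - F s| < 1 by near: s.
  have s3 := HS k t; have s4 := HS k s.
  have s5 : 2 * q k * (2 * F t + 1) < e / 2.
    move: kd; rewrite ltr_pdivlMr; last by rewrite mulr_gt0 // ltr_wpDl // mulr_ge0.
    by have := q0 k; nra.
  have s6 : F s <= F t + 1 by move: s2; rewrite ltr_norml; lra.
  have s7 : 2 * q k * F s <= 2 * q k * (F t + 1).
    by rewrite ler_wpM2l // mulr_ge0 // ltW.
  move: s1 s3 s4; rewrite !ltr_norml !ler_norml; nra.
have PH : H \in @PG_pred R n.
  apply: (PG_add2 (PG_funP (S 0%N)) (PG_funP (2 *: F)) cH) => t.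
  have := HS 0%N t; rewrite expr0 mulr1 PG_scaleE => HS0.
  rewrite [X in _ <= _ + X]ger0_norm ?mulr_ge0 //.
  have a1 := ler_norm (S 0%N t); have a2 := ler_norm (- S 0%N t).
  rewrite normrN in a2; move: HS0; rewrite !ler_norml; lra.
exists (MkPG H PH) => k.
rewrite -SE -(calcB Psi_calc) -(calc_abs Psi_calc) -(calcZ Psi_calc).
apply: (calc_homo Psi_calc) => t.
by rewrite pgabsE PG_addE PG_oppE PG_scaleE; exact: HS.
Unshelve. all: by end_near.
Qed.

End UniformLift.

Section Necessity.
Variables (R : realType) (X : latticeAlg R) (X_arch : archimedean_vlattice X).
Variables (n : nat) (x : 'I_n -> X) (Psi : PG R n -> X).
Hypotheses (X_f : is_f_algebra X) (Psi_calc : is_PG_calculus_at x Psi).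
Variable m : nat.
Hypothesis m0 : (0 < m)%N.

Let f : X := Psi (weight R n).
Let e : X := f ^+ m.
Local Notation q k := (2^-1 ^+ k : R).

Let f1 : (1 : X) <= f. Proof. exact: calc_weight_ge1 Psi_calc. Qed.
Let e0 : 0 <= e. Proof. by apply: power_ge0; [exact: X_f|exact: f1]. Qed.
Let q0 k : 0 < q k. Proof. by rewrite exprn_gt0. Qed.

Let lift (h : nat -> PG R n) :
  (forall k, vabs (Psi (h k.+1) - Psi (h k)) <= q k *: e) ->
  exists H : PG R n, forall k, vabs (Psi H - Psi (h k)) <= (2 * q k) *: e.
Proof.
rewrite /e /f -(calcX Psi_calc); apply: (uniform_lift Psi_calc) => t.
by rewrite PG_expE exprn_ge0 // (le_trans ler01) ?weight_ge1.
Qed.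

(** This is complete, and contains the closed sublattice as a closed subset. *)
Definition image_ideal : set X := [set y | order_ideal e y /\ exists h, Psi h = y].

Lemma image_ideal_sublattice : is_vector_sublattice image_ideal.
Proof.
have [[I0 Ilin] Ilat] := order_ideal_sublattice e0.
split; first split.
- by split=> //; exists 0; exact: calc0 Psi_calc.
- move=> a y z [Iy [h hy]] [Iz [g gz]]; split; first exact: Ilin.
  by exists (a *: h + g); rewrite (calc_lin Psi_calc) hy gz.
- move=> y z [Iy [h hy]] [Iz [g gz]]; have [II IU] := Ilat _ _ Iy Iz.
  split; split=> //; first by exists (h `&` g)%O; rewrite (calcI Psi_calc) hy gz.
  by exists (h `|` g)%O; rewrite (calcU Psi_calc) hy gz.
Qed.

Lemma image_ideal_closed : norm_closed e image_ideal.
Proof.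
move=> y Iy yB; split=> //.
have /choice[h hP] : forall k, exists h, vabs (y - Psi h) <= q k.+1 *: e.
  move=> k; have [a [Ia [h ha]] ya] := yB _ (q0 k.+1); exists h; rewrite ha.
  by apply: (ideal_norm_lt e0) => //; exact: (order_idealB e0).
have qS k : q k.+1 = q k / 2 by rewrite exprSr.
have [|H HP] := lift (h := h).
  move=> k; have h1 := hP k.+1; rewrite vabs_distC in h1.
  apply: (le_trans (vabs_dist_le h1 (hP k))); apply: (scale_homo e0).
  by rewrite !qS; have := q0 k; lra.
exists H; apply/esym/eqP; rewrite -subr_eq0; apply/eqP.
apply: (vabs_eq0 e0 X_arch) => l l0.
have [k kl] := half_power_small (d := l / 3) ltac:(lra).
have h1 := HP k; rewrite vabs_distC in h1.
apply: (le_trans (vabs_dist_le (hP k) h1)); apply: (scale_homo e0).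
by rewrite qS; have := q0 k; lra.
Qed.

(** A Cauchy subsequence of geometric rate lifts to [PG_n]; its limit is a limit
    of elements of the closed sublattice. *)
Lemma calculus_complete : norm_complete e (closed_sublattice e (range x)).
Proof.
have xB : range x `<=` image_ideal.
  move=> _ [i _ <-]; split; last by exists (PG_proj R i); exact: calc_proj.
  apply/(order_idealP e0); exists 1 => //; rewrite scale1r.
  apply: (@le_trans _ _ f); last by rewrite -[f]expr1; exact: power_homo.
  rewrite -(calc_proj Psi_calc) -(calc_abs Psi_calc); apply: (calc_homo Psi_calc) => t.
  rewrite pgabsE weightE (bigD1 i) //= addrCA lerDl.
  by rewrite addr_ge0 // sumr_ge0.
have xI : range x `<=` order_ideal e by move=> y /xB[].
have LB : closed_sublattice e (range x) `<=` image_ideal.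
  apply: smallest_sub => //; split; last exact: image_ideal_closed.
    exact: image_ideal_sublattice.
  by move=> y [].
move=> u uL uC.
have uI k : order_ideal e (u k) by have [] := LB _ (uL k).
have /choice[h hu] : forall k, exists h, Psi h = u k.
  by move=> k; have [] := LB _ (uL k).
have /choice[N NP] : forall k, exists N, forall i j : nat, (N <= i)%N -> (N <= j)%N ->
    vabs (u i - u j) <= q k *: e.
  move=> k; have [N NP] := uC _ (q0 k); exists N => i j Ni Nj.
  by apply: (ideal_norm_lt e0); [exact: (order_idealB e0)|exact: NP].
(* Summing the thresholds makes [phi] monotone. *)
pose phi k := (\sum_(i < k.+1) N i)%N.
have phiN k : (N k <= phi k)%N by rewrite /phi big_ord_recr leq_addl.
have phiS k : (phi k <= phi k.+1)%N by rewrite /phi [X in (_ <= X)%N]big_ord_recr leq_addr.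
have [|H HP] := lift (h := h \o phi).
  move=> k; rewrite /= !hu; apply: NP; last exact: phiN.
  exact: leq_trans (phiN k) (phiS k).
have yI : order_ideal e (Psi H).
  have -> : Psi H = (Psi H - u (phi 0%N)) - (0 - u (phi 0%N)).
    by rewrite opprB subr0 subrK.
  have [[I0 _] _] := order_ideal_sublattice e0.
  apply: (order_idealB e0); last exact: (order_idealB e0).
  apply/(order_idealP e0); exists (2 * q 0%N); first by rewrite mulr_ge0 // ltW.
  by have := HP 0%N; rewrite /= hu.
have near_y k i : (phi k <= i)%N -> vabs (u i - Psi H) <= (q k + 2 * q k) *: e.
  move=> ki; apply: (@vabs_dist_le _ _ _ _ _ _ (u (phi k))).
    by apply: NP; [exact: leq_trans ki|exact: phiN].
  by rewrite vabs_distC -hu; exact: HP.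
have norm_y k i : (phi k <= i)%N -> ideal_norm e (u i - Psi H) <= q k + 2 * q k.
  by move=> ki; apply: ideal_norm_le; [rewrite addr_ge0 ?mulr_ge0 // ltW|exact: near_y].
exists (Psi H).
  apply: (@closed_sublattice_closed _ _ e (range x)) => // eps eps0.
  have [k kl] := half_power_small (d := eps / 3) ltac:(lra).
  exists (u (phi k)) => //; apply: (@le_lt_trans _ _ (2 * q k)); last lra.
  by apply: ideal_norm_le; [rewrite mulr_ge0 // ltW|rewrite -hu; exact: HP].
apply/cvgrPdist_lt => eps eps0.
have [k kl] := half_power_small (d := eps / 3) ltac:(lra).
near=> i.
rewrite sub0r normrN ger0_norm ?ideal_norm_ge0 //.
apply: (@le_lt_trans _ _ (q k + 2 * q k)); last lra.
by apply: norm_y; near: i; exact: nbhs_infty_ge.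
Unshelve. all: by end_near.
Qed.

End Necessity.

(** * Sufficiency *)

Lemma bigjoin_le (R : realType) (X : latticeAlg R) (I : eqType) (r : seq I)
    (F : I -> X) (c f : X) :
  \big[Order.join/c]_(i <- r) F i <= f -> c <= f /\ forall i, i \in r -> F i <= f.
Proof.
elim: r => [|i r IHr]; first by rewrite big_nil.
rewrite big_cons leUx => /andP[Fi /IHr[cf Fr]]; split=> // j.
by rewrite in_cons => /orP[/eqP ->|/Fr].
Qed.

Section Sufficiency.
Variables (R : realType) (X : latticeAlg R) (X_arch : archimedean_vlattice X).
Hypothesis X_f : is_f_algebra X.
Variables (n : nat) (x : 'I_n -> X).

(** The constant 1 is adjoined to the generators, since sublattices generated
    by the [x i] alone represent only positively homogeneous functions. *)
Definition with_one (i : 'I_n.+1) : X := if unlift ord0 i is Some j then x j else 1.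

Variable f : X.
Hypothesis f_ge : forall i, vabs (with_one i) <= f.
Hypothesis f_complete : forall m, (0 < m)%N ->
  norm_complete (f ^+ m) (closed_sublattice (f ^+ m) (range with_one)).
Local Notation q k := (2^-1 ^+ k : R).

Let f1 : (1 : X) <= f.
Proof. by have := f_ge ord0; rewrite /with_one unlift_none; exact: le_trans (vabs_ge _). Qed.

Let x_le i : vabs (x i) <= f.
Proof. by have := f_ge (lift ord0 i); rewrite /with_one liftK. Qed.

Let q0 k : 0 < q k. Proof. by rewrite exprn_gt0. Qed.

Definition st_point (Q : X -> Prop) : 'rV[R]_n := \row_i st Q (x i).

(** By separation, at most one polynomially bounded [y] is the value at [x] of
    [h] in this sense. *)
Definition represents (h : PG R n) (y : X) : Prop :=
  forall Q, prime_cone Q -> finite Q f -> st Q y = h (st_point Q).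

Lemma st_weight_le Q : prime_cone Q -> finite Q f ->
  weight R n (st_point Q) <= n.+1%:R * st Q f.
Proof.
move=> Qp ff; have sf1 : 1 <= st Q f.
  by rewrite -(st1 X_f Qp); apply: st_homo => //; exact: finite1.
have hi i : `|st Q (x i)| <= st Q f.
  have fx := finite_le X_f Qp (x_le i) ff.
  have := x_le i; rewrite vabs_le => /andP[x1 x2].
  rewrite ler_norml lerNl -stN //.
  by apply/andP; split; apply: st_homo => //; exact: finiteN.
rewrite weightE -natr1 addrC mulrDl mul1r lerD //.
rewrite -[n in n%:R](card_ord n) -sumr_const mulr_suml ler_sum // => i _.
by rewrite mxE mul1r.
Qed.

Section Level.
Variable m : nat.
Hypothesis m0 : (0 < m)%N.
Let e : X := f ^+ m.
Let L := closed_sublattice e (range with_one).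
Let e0 : 0 <= e. Proof. by apply: power_ge0; [exact: X_f|exact: f1]. Qed.

Let gens_ideal : range with_one `<=` order_ideal e.
Proof.
move=> _ [i _ <-]; apply/(order_idealP e0); exists 1 => //; rewrite scale1r.
by apply: (le_trans (f_ge i)); rewrite -[f]expr1; exact: power_homo.
Qed.

Let L_ideal : L `<=` order_ideal e.
Proof. exact: (closed_sublattice_ideal e0 gens_ideal). Qed.

Lemma level_bounded y : L y -> poly_bounded f y.
Proof. by move=> /L_ideal/(order_idealP e0)[l l0 yl]; exists m, l. Qed.

Let L_finite Q y : prime_cone Q -> finite Q f -> L y -> finite Q y.
Proof. by move=> Qp ff /level_bounded; exact: poly_bounded_finite. Qed.

Definition level_functions : set (PG R n) :=
  [set p | exists2 y, L y & represents p y].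

Lemma level_functions_approx (h : PG R n) N M eps : m = N.+1 -> 0 <= M ->
    (forall t, `|h t| <= M * weight R n t ^+ N) -> 0 < eps ->
  exists2 p, level_functions p & forall t, `|h t - p t| <= eps * weight R n t ^+ m.
Proof.
move=> mN M0 hM eps0; rewrite mN.
have [[L0 Llin] Llat] := @closed_sublattice_sublattice _ _ e (range with_one).
have gen i : L (with_one i) by apply: closed_sublattice_gen; exists i.
apply: (weighted_lattice_approximation _ _ _ _ M0 hM eps0).
- exists 1; first by have := gen ord0; rewrite /with_one unlift_none.
  by move=> Q Qp ff; rewrite st1.
- move=> i; exists (x i); first by have := gen (lift ord0 i); rewrite /with_one liftK.
  by move=> Q Qp ff; rewrite /= mxE.
- move=> c p r [y Ly yp] [z Lz zr]; exists (c *: y + z); first exact: Llin.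
  move=> Q Qp ff; have [fy fz] := (L_finite Qp ff Ly, L_finite Qp ff Lz).
  by rewrite stD ?stZ ?yp ?zr //; exact: finiteZ.
- move=> p r [y Ly yp] [z Lz zr]; have [LI LU] := Llat _ _ Ly Lz.
  split; [exists (y `&` z)%O|exists (y `|` z)%O] => // Q Qp ff;
    have [fy fz] := (L_finite Qp ff Ly, L_finite Qp ff Lz).
    by rewrite stI // yp // zr // PG_meetE.
  by rewrite stU // yp // zr // PG_joinE.
Qed.

End Level.

(** The approximants of [h] have representatives in the sublattice, whose
    distances are controlled through their standard parts; the limit provided by
    completeness represents [h]. *)
Lemma exists_representative (h : PG R n) : exists2 y, poly_bounded f y & represents h y.
Proof.
have [N [M [M0 hM]]] := PG_growth h.
set m := N.+1; pose e : X := f ^+ m; pose K : R := n.+1%:R ^+ m.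
pose L := closed_sublattice e (range with_one).
have e0 : 0 <= e by exact: (power_ge0 X_f f1).
have K0 : 0 < K by rewrite exprn_gt0.
have /choice[p /all_and2[pL hp]] : forall k, exists p, level_functions m p /\
    forall t, `|h t - p t| <= q k * weight R n t ^+ m.
  move=> k; have [p Lp hp] := level_functions_approx (isT : (0 < m)%N) erefl M0
    (hM N (leqnn N)) (q0 k).
  by exists p.
have /choice[y yP] : forall k, exists y, L y /\ represents (p k) y.
  by move=> k; have [y] := pL k; exists y.
have yb k : poly_bounded f (y k) by exact: (@level_bounded m isT _ (proj1 (yP k))).
have wK Q : prime_cone Q -> finite Q f -> weight R n (st_point Q) ^+ m <= K * st Q e.
  move=> Qp ff; rewrite stX // -exprMn lerXn2r ?nnegrE ?st_weight_le //.
    by rewrite (le_trans ler01) ?weight_ge1.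
  by apply: le_trans (st_weight_le Qp ff); rewrite (le_trans ler01) ?weight_ge1.
have hpK k Q : prime_cone Q -> finite Q f ->
    `|h (st_point Q) - st Q (y k)| <= q k * K * st Q e.
  move=> Qp ff; rewrite (proj2 (yP k)) //; apply: (le_trans (hp k _)).
  by rewrite -mulrA ler_wpM2l ?wK // ltW.
have ydist i j : vabs (y i - y j) <= ((q i + q j) * K) *: e.
  have yle i' j' : y i' - y j' <= ((q i' + q j') * K) *: e.
    apply: (st_separation X_f f1 X_arch).
    - by apply: poly_boundedD => //; exact: poly_boundedN.
    - apply: poly_boundedZ; exists m, 1; split=> //.
      by rewrite scale1r vabs_id.
    move=> Q Qp ff; have fe : finite Q e by exact: finiteX.
    have [fi fj] := (poly_bounded_finite X_f Qp ff (yb i'), poly_bounded_finite X_f Qp ff (yb j')).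
    rewrite stD ?stN ?stZ //; last exact: finiteN.
    have := hpK i' Q Qp ff; have := hpK j' Q Qp ff.
    rewrite !ler_norml !mulrDl; lra.
  by rewrite vabs_le yle opprB [q i + _]addrC yle.
have qS k l : (k <= l)%N -> q l <= q k.
  by move=> kl; apply: ler_wiXn2l => //; lra.
have [|z Lz zlim] := f_complete (isT : (0 < m)%N) (u := y) (fun k => proj1 (yP k)).
  move=> eps eps0.
  have [k kd] := half_power_small (d := eps / (2 * K)) ltac:(by rewrite divr_gt0 // mulr_gt0).
  exists k => i j ki kj; apply: (@le_lt_trans _ _ ((q i + q j) * K)).
    by apply: ideal_norm_le => //; rewrite mulr_ge0 ?addr_ge0 // ltW.
  move: kd; rewrite ltr_pdivlMr ?mulr_gt0 //; have := qS _ _ ki; have := qS _ _ kj; nra.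
have zb : poly_bounded f z by exact: (@level_bounded m isT _ Lz).
exists z => // Q Qp ff.
have fe : finite Q e by exact: finiteX.
have se0 : 0 < st Q e.
  rewrite (@lt_le_trans _ _ 1) // -(st1 X_f Qp); apply: st_homo => //; first exact: finite1.
  exact: power_ge1.
apply/eqP; rewrite -subr_eq0 -normr_le0; apply/ler_addgt0Pl => eps eps0; rewrite addr0.
(* The error is [d] from the limit and [d * K] from the approximant, times
   [st Q e]. *)
pose d := eps / ((1 + K) * st Q e).
have d0 : 0 < d by rewrite divr_gt0 // mulr_gt0 // addr_gt0.
have [k qk] := half_power_small d0.
have [l lk zl] : exists2 l, (k <= l)%N & ideal_norm e (y l - z) < d.
  move/cvgrPdist_lt: zlim => /(_ d d0)[l _ /(_ (maxn k l) (leq_maxr _ _))].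
  rewrite sub0r normrN ger0_norm ?ideal_norm_ge0 // => zl.
  by exists (maxn k l) => //; exact: leq_maxl.
have LI : L `<=` order_ideal e.
  apply: closed_sublattice_ideal => // _ [i _ <-]; apply/(order_idealP e0); exists 1 => //.
  by rewrite scale1r; apply: (le_trans (f_ge i)); rewrite -[f]expr1; exact: power_homo.
have := ideal_norm_lt e0 (order_idealB e0 (LI _ (proj1 (yP l))) (LI _ Lz)) zl.
have [fy fz] := (poly_bounded_finite X_f Qp ff (yb l), poly_bounded_finite X_f Qp ff zb).
rewrite vabs_le opprB => /andP[h1 h2].
have fde : finite Q (d *: e) by exact: finiteZ.
have fB a b : finite Q a -> finite Q b -> finite Q (a - b).
  by move=> fa fb; apply: finiteD => //; exact: finiteN.
have {}h1 := st_homo X_f Qp (fB _ _ fy fz) fde h1.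
have {}h2 := st_homo X_f Qp (fB _ _ fz fy) fde h2.
move: h1 h2; rewrite !stD ?stN ?stZ //; [|exact: finiteN|exact: finiteN] => h1 h2.
have h3 := hpK l Q Qp ff.
have h4 : q l * K * st Q e <= d * K * st Q e.
  rewrite ler_wpM2r ?(ltW se0) // ler_wpM2r ?(ltW K0) //.
  by apply: (le_trans (qS _ _ lk)); exact: ltW.
have h5 : eps = d * st Q e + d * K * st Q e.
  have <- : d * ((1 + K) * st Q e) = eps.
    by rewrite /d divfK // gt_eqF // mulr_gt0 // addr_gt0.
  by ring.
move: h3; rewrite !ler_norml; lra.
Qed.

Lemma exists_PG_calculus : exists Psi : PG R n -> X, is_PG_calculus_at x Psi.
Proof.
have /choice[Psi /all_and2[bnd rep]] : forall h, exists y, poly_bounded f y /\ represents h y.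
  by move=> h; have [y] := exists_representative h; exists y.
have fin Q h : prime_cone Q -> finite Q f -> finite Q (Psi h).
  by move=> Qp ff; exact: (poly_bounded_finite X_f Qp ff (bnd h)).
have uniq h y : poly_bounded f y -> represents h y -> Psi h = y.
  move=> yb yr; apply: (st_inj X_f f1 X_arch (bnd h) yb) => Q Qp ff.
  by rewrite rep // yr.
exists Psi; split; first split.
- move=> c g h; apply: uniq => [|Q Qp ff].
    by apply: poly_boundedD => //; exact: poly_boundedZ.
  by rewrite stD ?stZ ?rep //; [exact: fin|apply: finiteZ => //; exact: fin|exact: fin].
- move=> g h; apply: uniq => [|Q Qp ff]; first exact: poly_boundedM.
  by rewrite stM ?rep //; exact: fin.
- move=> g h; apply: uniq => [|Q Qp ff]; first exact: poly_boundedI.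
  by rewrite stI ?rep //; [apply/esym; exact: PG_meetE|exact: fin|exact: fin].
- move=> g h; apply: uniq => [|Q Qp ff]; first exact: poly_boundedU.
  by rewrite stU ?rep //; [apply/esym; exact: PG_joinE|exact: fin|exact: fin].
- by apply: uniq => [|Q Qp ff]; [exact: poly_bounded1|rewrite st1].
- move=> i; apply: uniq => [|Q Qp ff]; last by rewrite /= mxE.
  by exists 1%N, 1; rewrite scale1r expr1.
Qed.

End Sufficiency.

Theorem corollary3p7 (R : realType) (X : latticeAlg R)
    (X_archimedean : archimedean_vlattice X) :
  (admits_PG_calculus X <->
     is_f_algebra X /\
     forall n : nat, (0 < n)%N -> forall x : 'I_n -> X,
       exists2 f : X,
         \big[Order.join/1]_(i < n) vabs (x i) <= f &
         forall m : nat, (0 < m)%N ->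
           norm_complete (f ^+ m) (closed_sublattice (f ^+ m) (range x)))
  /\
  (admits_PG_calculus X ->
     (forall n : nat, (0 < n)%N -> forall x : 'I_n -> X,
        exists! Psi : PG R n -> X, is_PG_calculus_at x Psi) /\
     (forall m n : nat, (0 < m)%N -> (0 < n)%N ->
        forall (x : 'I_n -> X) (Psi_x : PG R n -> X),
        is_PG_calculus_at x Psi_x ->
        forall (fs : 'I_m -> PG R n) (Psi_fs : PG R m -> X),
        is_PG_calculus_at (fun i => Psi_x (fs i)) Psi_fs ->
        forall g : PG R m, Psi_fs g = Psi_x (PG_comp g fs))).
Proof.
split; first split.
- move=> adm; have X_f := PG_calculus_f_algebra adm; split=> // n n0 x.
  have [Psi calc] := adm n n0 x.
  exists (Psi (weight R n)).
    apply: (big_ind (fun y : X => y <= Psi (weight R n))) => [|y z yw zw|i _].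
    + exact: calc_weight_ge1 calc.
    + by rewrite leUx yw.
    + rewrite -(calc_proj calc) -(calc_abs calc); apply: (calc_homo calc) => t.
      rewrite pgabsE weightE (bigD1 i) //= addrCA lerDl.
      by rewrite addr_ge0 // sumr_ge0.
  by move=> m m0; exact: (calculus_complete X_archimedean X_f calc m0).
- move=> [X_f H] n n0 x.
  have [f fge fcomp] := H n.+1 isT (with_one x).
  apply: (exists_PG_calculus X_archimedean X_f _ fcomp) => i.
  by have [_ ->] := bigjoin_le fge; rewrite ?mem_index_enum.
- move=> adm; have X_f := PG_calculus_f_algebra adm; split.
    move=> n n0 x; have [Psi calc] := adm n n0 x; exists Psi; split=> // Psi' calc'.
    exact: (PG_calculus_unique X_archimedean X_f calc calc').
  move=> m n m0 n0 x Psi_x calc fs Psi_fs calc' g.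
  have := PG_calculus_comp fs calc.
  by move=> /(PG_calculus_unique X_archimedean X_f calc') ->.
Qed.
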